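(* Let $X=X_N$ be the $N\times N$ GOE and let $A_1,\dots,A_n$ (depending on $N$) be constant $N\times N$ matrices such that $A_1,\dots,A_n$ have a joint infinitesimal limit distribution and $A_1,\dots,A_n,A_1^t,\dots,A_n^t$ have a joint limit distribution, with limit variables $a_1,\dots,a_n,a_1^t,\dots,a_n^t$ in an infinitesimal probability space $(\mathcal{A},\varphi,\varphi')$. Let $x$ denote a semi-circular variable, i.e. its free cumulants are $\kappa_2=1$ and $\kappa_k=0$ for $k\neq2$. Then $$\lim_{N\to\infty} N\Big(\mathrm{E}(\mathrm{tr}(XA_1\cdots XA_n))-\sum_{\pi\in NC(n)}\kappa_\pi(x,\dots,x)\,\varphi_{K(\pi)}(a_1,\dots,a_n)\Big)$$ $$=\sum_{\pi\in NC(n)}\kappa_\pi(x,\dots,x)\,\partial\varphi_{K(\pi)}(a_1,\dots,a_n)+\sum_{\rho\in NC_2^\delta(n,-n)}\kappa_\rho(x,\dots,x)\,\varphi_{K^\delta(\rho)}(a_1,\dots,a_n).$$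
   Context: GOE: $X_N=\frac{1}{\sqrt{2N}}(G+G^{t})$ where $G=(g_{ij})_{i,j=1}^N$ has i.i.d. real $\mathcal{N}(0,1)$ entries. $\mathrm{tr}=\frac1N\mathrm{Tr}$. For a matrix or variable $A$ write $A^{(1)}=A$, $A^{(-1)}=A^t$ (transpose). Limit assumptions: for all $k\ge 1$, $i_1,\dots,i_k\in\{1,\dots,n\}$ and $\epsilon_1,\dots,\epsilon_k\in\{\pm1\}$, the limit $\varphi(a_{i_1}^{(\epsilon_1)}\cdots a_{i_k}^{(\epsilon_k)}):=\lim_N\mathrm{tr}(A_{i_1}^{(\epsilon_1)}\cdots A_{i_k}^{(\epsilon_k)})$ exists, and $\varphi'(a_{i_1}\cdots a_{i_k}):=\lim_N N\big(\mathrm{tr}(A_{i_1}\cdots A_{i_k})-\varphi(a_{i_1}\cdots a_{i_k})\big)$ exists. Here $\varphi,\varphi'$ are linear with $\varphi(1)=1$, $\varphi'(1)=0$. Multiplicative notation: $NC(n)$ is the set of non-crossing partitions of $\{1,\dots,n\}$, $K(\pi)$ the Kreweras complement of $\pi$ (the blocks of $K(\pi)$ are the cycles of $\pi^{-1}\gamma$, $\gamma=(1,2,\dots,n)$, where blocks of $\pi$ are read as cycles in increasing order). $\kappa_\pi(x,\dots,x)=\prod_{V\in\pi}\kappa_{|V|}$; so it equals 1 if $\pi$ is a pairing and 0 otherwise. Likewise $\kappa_\rho(x,\dots,x)=1$ for a pairing $\rho$. For a partition $\pi$ of $\{1,\dots,n\}$, $\varphi_\pi(a_1,\dots,a_n)=\prod_{V=(i_1<\dots<i_l)\in\pi}\varphi(a_{i_1}\cdots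 a_{i_l})$ and $$\partial\varphi_\pi(a_1,\dots,a_n)=\sum_{V=(i_1<\dots<i_k)\in\pi}\varphi'(a_{i_1}\cdots a_{i_k})\prod_{W\in\pi,\,W\ne V,\,W=(j_1<\dots<j_l)}\varphi(a_{j_1}\cdots a_{j_l}).$$ Definition of $NC_2^\delta(n,-n)$. Let $[\pm n]=\{1,\dots,n,-1,\dots,-n\}$, $S_{\pm n}$ its permutation group (products composed right to left), $\gamma=(1,2,\dots,n)$ extended to act trivially on negative numbers, $\delta(k)=-k$. $\#(\cdot)$ counts cycles. Pairings (partitions with all blocks of size 2) are identified with fixed-point-free involutions. For $n$ even, $NC_2^\delta(n,-n)$ is the set of pairings $\rho$ of $[\pm n]$ such that $\rho$ has at least one pair $(r,s)$ with $r,s$ of opposite signs, $\#(\gamma\delta\gamma^{-1}\delta\rho)=n$, $\rho$ commutes with $\delta$ (equivalently $(r,s)\in\rho$ implies $(-r,-s)\in\rho$), and $(r,-r)$ is never a pair of $\rho$. For $n$ odd it is empty. Definition of $\varphi_{K^\delta(\rho)}$. For $\rho\in NC_2^\delta(n,-n)$, the cycles of $\delta\gamma^{-1}\delta\,\rho\,\gamma$ come in pairs $c_i,c_i'$ with $c_i'=\delta c_i^{-1}\delta$, so $\delta\gamma^{-1}\delta\rho\gamma=c_1c_1'\cdots c_kc_k'$. Choose one cycle from each pair, say $c_i=(j_1,\dots,j_r)$, and put $\tilde c_i=(|j_1|,\dots,|j_r|)$ and $\eta_{|j_l|}=j_l/|j_l|$. Then $\sigma=\tilde c_1\cdots\tilde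 c_k\in S_n$, $\eta\in\{\pm1\}^n$, and $$\varphi_{K^\delta(\rho)}(a_1,\dots,a_n)=\varphi_\sigma(a_1^{(\eta_1)},\dots,a_n^{(\eta_n)})=\prod_{(i_1,\dots,i_l)\text{ cycle of }\sigma}\varphi(a_{i_1}^{(\eta_{i_1})}\cdots a_{i_l}^{(\eta_{i_l})}),$$ which does not depend on the choices. *)

(* Defs.v *)
From HB Require Import structures.
From mathcomp Require Import all_boot all_order all_algebra all_fingroup.
From mathcomp Require Import complex.
From mathcomp Require Import all_classical all_reals all_analysis.

Set Implicit Arguments.
Unset Strict Implicit.
Unset Printing Implicit Defensive.

Import Order.TTheory GRing.Theory Num.Theory.
Import numFieldNormedType.Exports.

Local Open Scope ring_scope.
Local Open Scope complex_scope.

(* The formulas quoted in comments compose permutations from right to left,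
   whereas (s * t)%g x = t (s x): products appear in reverse order in the code. *)

(* The permutation with underlying map f; by convention the identity when f is
   not injective. *)
Definition perm_of_fun (T : finType) (f : T -> T) : {perm T} :=
  insubd (1%g : {perm T}) [ffun x => f x].

Lemma perm_of_funE (T : finType) (f : T -> T) :
  injective f -> perm_of_fun f =1 f.
Proof.
move=> f_inj x; have fP : injectiveb [ffun x => f x].
  by apply/injectiveP => y z; rewrite !ffunE => /f_inj.
suff -> : perm_of_fun f = perm f_inj by rewrite permE.
apply: val_inj; rewrite /perm_of_fun val_insubd fP.
by apply/ffunP => y; rewrite ffunE -(permE f_inj) pvalE.
Qed.

(* {1, ..., n} is encoded as 'I_n, so that gamma below is (1, 2, ..., n). *)
Definition gamma (n : nat) : {perm 'I_n} := perm (@ordS_inj n).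

Definition noncrossing (n : nat) (pi : {set {set 'I_n}}) : bool :=
  [forall a : 'I_n, forall b : 'I_n, forall c : 'I_n, forall d : 'I_n,
     [&& (a < b)%N, (b < c)%N, (c < d)%N,
         finset.pblock pi a == finset.pblock pi c & finset.pblock pi b == finset.pblock pi d]
     ==> (finset.pblock pi a == finset.pblock pi b)].

Definition NC (n : nat) : {set {set {set 'I_n}}} :=
  [set pi | finset.partition pi [set: 'I_n]%SET && noncrossing pi]%SET.

(* The blocks of pi read as cycles; enum lists a block in increasing order. *)
Definition next_in_block (n : nat) (pi : {set {set 'I_n}}) (i : 'I_n) : 'I_n :=
  next (enum (finset.pblock pi i)) i.

Lemma next_in_block_inj (n : nat) (pi : {set {set 'I_n}}) :
  finset.partition pi [set: 'I_n]%SET -> injective (next_in_block pi).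
Proof.
case/and3P => /eqP cov tI _.
have inb k : k \in finset.pblock pi k by rewrite finset.mem_pblock cov finset.in_setT.
have nb k : next_in_block pi k \in finset.pblock pi k.
  by rewrite /next_in_block -mem_enum mem_next mem_enum.
have same k : finset.pblock pi (next_in_block pi k) = finset.pblock pi k.
  by apply: finset.same_pblock => //; apply: nb.
move=> i j eq_ij; have eq_b : finset.pblock pi i = finset.pblock pi j.
  by rewrite -(same i) eq_ij same.
move: eq_ij; rewrite /next_in_block eq_b => /(congr1 (prev (enum (finset.pblock pi j)))).
by rewrite !prev_next ?enum_uniq.
Qed.

Definition perm_of_part (n : nat) (pi : {set {set 'I_n}}) : {perm 'I_n} :=
  perm_of_fun (next_in_block pi).

(* Cycles of pi^{-1} gamma. *)
Definition kreweras (n : nat) (pi : {set {set 'I_n}}) : {set {set 'I_n}} :=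
  porbits (gamma n * (perm_of_part pi)^-1)%g.

(* kappa_pi(x, ..., x), where kappa lists the free cumulants of x. *)
Definition cumulant_part (C : comPzRingType) (kappa : nat -> C) (T : finType)
    (pi : {set {set T}}) : C :=
  \prod_(V in pi) kappa #|V|.

(* Free cumulants of a semi-circular variable. *)
Definition semicircular (C : comPzRingType) (k : nat) : C :=
  if k == 2%N then 1 else 0.

Section Functionals.
Variables (C : comNzRingType) (B : algType C) (n : nat).
Implicit Types (f : {scalar B}) (b : 'I_n -> B).

Definition block_word b (V : {set 'I_n}) : B := \prod_(i <- enum V) b i.

Definition fun_part f (pi : {set {set 'I_n}}) b : C :=
  \prod_(V in pi) f (block_word b V).

Definition dfun_part f f' (pi : {set {set 'I_n}}) b : C :=
  \sum_(V in pi)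
    f' (block_word b V) * \prod_(W in pi | W != V) f (block_word b W).

(* A cycle of s, listed as (x, s x, s (s x), ...) from its least element x. *)
Definition cycle_seq (s : {perm 'I_n}) (c : {set 'I_n}) : seq 'I_n :=
  if enum c is x :: _ then traject s x #|c| else [::].

Definition fun_perm f (s : {perm 'I_n}) b : C :=
  \prod_(c in porbits s) f (\prod_(i <- cycle_seq s c) b i).

End Functionals.

(* The point (k, e) of [+-n] stands for -k if e is true, and k otherwise. *)
Definition signed (n : nat) : finType := ('I_n * bool)%type.

Definition sdelta_fun (n : nat) (r : signed n) : signed n := (r.1, ~~ r.2).

Lemma sdelta_fun_inj (n : nat) : injective (@sdelta_fun n).
Proof. by move=> [k e] [l f] [-> /(congr1 negb)]; rewrite !negbK => ->. Qed.

Definition sdelta (n : nat) : {perm signed n} := perm (@sdelta_fun_inj n).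

Definition sgamma_fun (n : nat) (r : signed n) : signed n :=
  if r.2 then r else (gamma n r.1, r.2).

Lemma sgamma_fun_inj (n : nat) : injective (@sgamma_fun n).
Proof. by move=> [k []] [l []] //= [/perm_inj ->]. Qed.

Definition sgamma (n : nat) : {perm signed n} := perm (@sgamma_fun_inj n).

(* Pairings are represented by fixed-point-free involutions; the porbits
   condition is #(gamma delta gamma^{-1} delta rho) = n. *)
Definition NC2delta (n : nat) : {set {perm signed n}} :=
  [set rho : {perm signed n} |
     [&& ~~ odd n,
         [forall r, (rho r != r) && (rho (rho r) == r)],
         [exists r, (rho r).2 != r.2],
         #|porbits (rho * sdelta n * (sgamma n)^-1 * sdelta n * sgamma n)%g|
           == n,
         [forall r, rho (sdelta n r) == sdelta n (rho r)] &
         [forall r, rho r != sdelta n r]]]%SET.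

Section KDelta.
Variables (n : nat) (rho : {perm signed n}).

(* delta gamma^{-1} delta rho gamma *)
Definition Kdelta_perm : {perm signed n} :=
  (sgamma n * rho * sdelta n * (sgamma n)^-1 * sdelta n)%g.

(* ch contains exactly one cycle of each pair c, c' = delta c^{-1} delta;
   cycles are identified with their supports.  When rho is in NC2delta n such a
   choice exists: c and c' are then disjoint, and delta maps cycles to cycles. *)
Definition cycle_choice (ch : {set {set signed n}}) : bool :=
  (ch \subset porbits Kdelta_perm) &&
  [forall c in porbits Kdelta_perm, (c \in ch) (+) (sdelta n @: c \in ch)%SET].

Definition chosen_cycles : {set {set signed n}} :=
  odflt finset.set0 [pick ch | cycle_choice ch].

(* eta k is true when -k, rather than k, lies on a chosen cycle. *)
Definition Kdelta_eta (k : 'I_n) : bool := (k, true) \in finset.cover chosen_cycles.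

Definition Kdelta_sigma : {perm 'I_n} :=
  perm_of_fun (fun k => (Kdelta_perm (k, Kdelta_eta k)).1).

End KDelta.

(* b^{(1)} = b and b^{(-1)} = bt, the sign -1 being encoded by true. *)
Definition eps_var (B : Type) (n : nat) (b bt : 'I_n -> B) (k : 'I_n) (e : bool)
    : B :=
  if e then bt k else b k.

Definition eps_mx (C : Type) (N : nat) (M : 'M[C]_N) (e : bool) : 'M[C]_N :=
  if e then M^T else M.

Definition fun_Kdelta (C : comNzRingType) (B : algType C) (n : nat)
    (f : {scalar B}) (rho : {perm signed n}) (b bt : 'I_n -> B) : C :=
  fun_perm f (Kdelta_sigma rho) (fun k => eps_var b bt k (Kdelta_eta rho k)).

Definition ntr (C : fieldType) (N : nat) (M : 'M[C]_N) : C :=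
  N%:R^-1 * \tr M.

Section LimitDistributions.
Local Open Scope classical_set_scope.
Variables (R : realType) (n : nat) (A : forall N : nat, 'I_n -> 'M[R[i]]_N).
Variables (B : algType R[i]) (phi phi' : {scalar B}) (a at_ : 'I_n -> B).

Definition joint_limit_distribution : Prop :=
  forall (k : nat) (j : 'I_k -> 'I_n) (e : 'I_k -> bool), (0 < k)%N ->
    (fun N : nat =>
       ntr (\prod_(l < k) eps_mx (A N (j l)) (e l)) : R[i]^o) @ \oo -->
    (phi (\prod_(l < k) eps_var a at_ (j l) (e l)) : R[i]^o).

Definition joint_infinitesimal_limit_distribution : Prop :=
  forall (k : nat) (j : 'I_k -> 'I_n), (0 < k)%N ->
    ((fun N : nat => ntr (\prod_(l < k) A N (j l)) : R[i]^o) @ \oo -->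
     (phi (\prod_(l < k) a (j l)) : R[i]^o)) /\
    ((fun N : nat =>
        N%:R * (ntr (\prod_(l < k) A N (j l)) - phi (\prod_(l < k) a (j l)))
        : R[i]^o) @ \oo -->
     (phi' (\prod_(l < k) a (j l)) : R[i]^o)).

End LimitDistributions.

Section GOE.
Local Open Scope classical_set_scope.
Variables (R : realType) (d : measure_display) (Om : measurableType d).
Variable P : probability Om R.

Definition mutually_independent (I : finType) (X : I -> {RV P >-> R}) : Prop :=
  forall (J : {set I}) (D : I -> set R),
    (forall i, i \in J -> measurable (D i)) ->
    P (\bigcap_(i in [set` J]) (X i @^-1` D i)) =
    (\prod_(i in J) P (X i @^-1` D i))%E.

Definition iid_std_normal (I : finType) (X : I -> {RV P >-> R}) : Prop :=
  mutually_independent X /\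
  forall i (D : set R), measurable D ->
    distribution P (X i) D = normal_prob 0 1 D.

Definition cexpectation (Y : Om -> R[i]) : R[i] :=
  fine 'E_P[fun w => complex.Re (Y w)]%E +i*
  fine 'E_P[fun w => complex.Im (Y w)]%E.

(* (G + G^t) / sqrt(2N), with G = (g_ij), as a complex matrix. *)
Definition goe (N : nat) (g : 'I_N * 'I_N -> {RV P >-> R}) (w : Om)
    : 'M[R[i]]_N :=
  let G := \matrix_(i < N, j < N) g (i, j) w in
  map_mx (real_complex R) ((Num.sqrt (2 * N%:R))^-1 *: (G + G^T)).

End GOE.

(* Main.v *)
(** By Wick's formula, N E(tr(X A_1 ... X A_n)) is a sum over the pairings rho of
    [+-n] that commute with delta and match no r with -r: such a rho is a pairing
    of the factors X together with, for each pair, one of the two terms of the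
    covariance E(x_ij x_kl) = (d_il d_jk + d_ik d_jl) / N.  Summing over the matrix
    indices attached to rho gives one trace per pair of cycles c, c' of
    delta gamma^-1 delta rho gamma, so the term of rho equals N^(q - n/2) times a
    product of q normalized traces.

    Building rho from transpositions, each of which adds at most one cycle, bounds
    q.  If rho has a pair of opposite signs, the first transposition joins the two
    cycles of gamma delta gamma^-1 delta, so q <= n/2, with equality exactly on
    NC_2^delta(n,-n).  If rho preserves signs it comes from a pairing p of [n]; then
    q <= n/2 - 1 when p crosses, and q = n/2 + 1 when p is non-crossing.  In the last
    case the cycles of p gamma are increasing, hence are the words of K(p), and the
    product rule for the limit N (f - lim f) produces the derivative of phi_K(p). *)

Require Import Defs.
From HB Require Import structures.
From mathcomp Require Import all_boot all_order all_algebra all_fingroup.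
From mathcomp Require Import complex.
From mathcomp Require Import all_classical all_reals all_analysis.
From mathcomp Require Import measurable_realfun ring lra.

Set Implicit Arguments.
Unset Strict Implicit.
Unset Printing Implicit Defensive.

Import Order.TTheory GRing.Theory Num.Theory.
Import numFieldNormedType.Exports.

Local Open Scope classical_set_scope.
Local Open Scope ring_scope.
Local Open Scope complex_scope.

(** * Sums over index functions and cycles of a permutation *)

(** Wick's formula has to be derived from the Gaussian density and from independence stated on
    events. Integration by parts yields E(x^(k+1)) = k E(x^(k-1)), so a product of standard normal
    variables obeys a recursion that pairs one chosen factor with each of the others. For fixed
    matrix indices, the number of compatible [rho] on a subset of the factors obeys the same
    recursion, up to constants due to the choice of a summand in each g_ij + g_ji; induction on the
    subset compares the two.

    On the combinatorial side the obstacle is that K^delta rests on an arbitrary choice of one cycle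
    in each pair. The index sums and cycle counts are therefore proved for any [sg] and [eta]
    satisfying [cycle_signs]. The chosen cycles of [rho] are one instance. A pairing p of [n],
    doubled to both signs, is another, with [sg] equal to p gamma and no transpose at all: the terms
    that require phi' only involve words in the matrices themselves, and for these words the
    infinitesimal limit is assumed. *)

Section IteratedSums.
Variables (C : comNzRingType) (T I : finType).
Implicit Types (u : T -> I) (L : seq T) (F a b : (T -> I) -> C).

Definition upd u y e : T -> I := fun k => if k == y then e else u k.

(** Summing over one value at a time allows the indices attached to one cycle to be summed while all
    the others stay fixed. *)
Fixpoint isum L F u : C :=
  if L is y :: L' then \sum_e isum L' F (upd u y e) else F u.

Definition indep_of L F :=
  forall u u', (forall k, k \notin L -> u k = u' k) -> F u = F u'.

Lemma sum_ffun_isum L F u0 : uniq L ->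
  \sum_(u : {ffun T -> I} | [forall k, (k \notin L) ==> (u k == u0 k)]) F u
  = isum L F u0.
Proof.
elim: L u0 => [|y L IH] u0 /=.
  move=> _; rewrite (big_pred1 [ffun k => u0 k]) => [|u /=].
    by congr F; apply/funext => k; rewrite ffunE.
  apply/forallP/eqP => [h|-> k]; last by rewrite ffunE.
  by apply/ffunP => k; rewrite ffunE; apply/eqP; apply: h.
case/andP=> yL uL; rewrite (partition_big (fun u : {ffun T -> I} => u y) predT)//=.
apply: eq_bigr => e _; rewrite -IH//; apply: eq_bigl => u.
apply/andP/forallP => [[/forallP h /eqP ue] k|h].
  apply/implyP => kL; rewrite /upd; have [->|ky] := eqVneq k y; first by rewrite ue.
  by have /implyP := h k; rewrite inE negb_or ky kL; apply.
split; last by have /implyP := h y; rewrite /upd eqxx; apply.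
apply/forallP => k; apply/implyP; rewrite inE negb_or => /andP[ky kL].
by have /implyP /(_ kL) := h k; rewrite /upd (negbTE ky).
Qed.

Lemma isum_cat L1 L2 F u : isum (L1 ++ L2) F u = isum L1 (isum L2 F) u.
Proof. by elim: L1 u => //= y L IH u; apply: eq_bigr => e _; apply: IH. Qed.

Lemma isumMl L a b u : indep_of L a ->
  isum L (fun v => a v * b v) u = a u * isum L b u.
Proof.
elim: L u => //= y L IH u ha; rewrite mulr_sumr; apply: eq_bigr => e _.
rewrite IH => [|v v' h]; last by apply: ha => k; rewrite inE negb_or => /andP[_ /h].
congr (_ * _); apply: ha => k; rewrite inE negb_or => /andP[ky _].
by rewrite /upd (negbTE ky).
Qed.

Lemma isumMr L b (c : C) u : isum L (fun v => b v * c) u = isum L b u * c.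
Proof. by elim: L u => //= y L IH u; rewrite mulr_suml; apply: eq_bigr. Qed.

Lemma eq_isum L a b u : a =1 b -> isum L a u = isum L b u.
Proof. by move=> /funext ->. Qed.

(** Fubini for factors that depend on disjoint sets of variables: each factor is constant in the
    variables of the others, and becomes the constant [t j] once its own are summed out. *)
Lemma isum_flatten (J : eqType) (s : seq J) (L : J -> seq T)
    (F : J -> (T -> I) -> C) (t : J -> C) u :
    uniq (flatten [seq L j | j <- s]) ->
    (forall j v, j \in s -> isum (L j) (F j) v = t j) ->
    (forall j v v', j \in s -> (forall k, k \in L j -> v k = v' k) ->
      F j v = F j v') ->
  isum (flatten [seq L j | j <- s]) (fun v => \prod_(j <- s) F j v) u
  = \prod_(j <- s) t j.
Proof.
elim: s u => [|j s IH] u /=; first by rewrite !big_nil.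
rewrite cat_uniq => /and3P[_ /hasPn Ld us] ht hF.
rewrite big_cons isum_cat -(ht j u) ?mem_head// -isumMr; apply: eq_isum => v.
under eq_isum do rewrite big_cons.
rewrite isumMl => [|w w' h].
  rewrite IH// => i w *; first by apply: ht; rewrite inE orbC; apply/orP; left.
  by apply: hF => //; rewrite inE orbC; apply/orP; left.
apply: hF => [|k kL]; first exact: mem_head.
by apply: h; apply/negP => /Ld; rewrite /= kL.
Qed.

End IteratedSums.

(** * Traces along the cycles of a permutation *)

Section CycleSums.
Variables (C : comNzRingType) (n N : nat) (M : 'I_n -> 'M[C]_N).

Fixpoint path_weight (x : 'I_n) (s : seq 'I_n) (z : 'I_n) (u : 'I_n -> 'I_N) : C :=
  if s is y :: s' then M x (u x) (u y) * path_weight y s' z u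
  else M x (u x) (u z).

Lemma path_weightE (sg : {perm 'I_n}) x s z u :
  path (frel sg) x s -> sg (last x s) = z ->
  \prod_(k <- x :: s) M k (u k) (u (sg k)) = path_weight x s z u.
Proof.
elim: s x => [|y s IH] x /=; first by move=> _ <-; rewrite big_seq1.
by case/andP => /eqP <- ps hz; rewrite big_cons IH.
Qed.

(** Summing out the index of an interior vertex is a matrix multiplication. The endpoint [z] may
    equal [x], which closes the path into a cycle. *)
Lemma isum_path_weight x s z u : uniq (x :: s) -> z \notin s ->
  isum s (path_weight x s z) u = (\prod_(i <- x :: s) M i) (u x) (u z).
Proof.
elim: s x u => [|y s IH] x u; first by rewrite big_seq1.
rewrite [uniq _]/= => /and3P[xys ys us]; rewrite inE negb_or => /andP[zy zs].
rewrite big_cons mxE [isum _ _ _]/=; apply: eq_bigr => e _.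
have {}ux : uniq (y :: s) by rewrite /= ys.
rewrite isumMl => [|v v' h].
  rewrite IH// /upd eqxx (negbTE zy) ifN// .
  by move: xys; rewrite inE negb_or => /andP[].
by move: xys; rewrite inE negb_or => /andP[_ xs]; rewrite !h.
Qed.

Lemma isum_cycle_weight x s u : uniq (x :: s) ->
  isum (x :: s) (path_weight x s x) u = \tr (\prod_(i <- x :: s) M i).
Proof.
move=> us; rewrite /= /mxtrace; apply: eq_bigr => e _.
rewrite isum_path_weight //; last by case/andP: us.
by rewrite /upd eqxx.
Qed.

Lemma cycle_seqP (s : {perm 'I_n}) c : c \in porbits s ->
  exists2 x, c = porbit s x & cycle_seq s c = traject s x #|porbit s x|.
Proof.
case/imsetP => x0 _ ->; rewrite /cycle_seq.
have := mem_enum (mem (porbit s x0)).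
case: (enum _) => [/(_ x0)|x e /(_ x)]; first by rewrite porbit_id.
by rewrite mem_head => /esym; rewrite -eq_porbit_mem => /eqP <-; exists x.
Qed.

Lemma mem_cycle_seq (s : {perm 'I_n}) c : c \in porbits s -> cycle_seq s c =i c.
Proof. by case/cycle_seqP => x -> -> k; rewrite porbit_traject. Qed.

Lemma uniq_cycle_seq (s : {perm 'I_n}) c : c \in porbits s -> uniq (cycle_seq s c).
Proof. by case/cycle_seqP => x -> ->; exact: uniq_traject_porbit. Qed.

Lemma prod_porbits (D : comPzRingType) (s : {perm 'I_n}) (F : 'I_n -> D) :
  \prod_k F k = \prod_(c in porbits s) \prod_(k in c) F k.
Proof.
rewrite (partition_big (porbit s) (mem (porbits s)))//=; last first.
  by move=> k _; exact: imset_f.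
apply: eq_bigr => c /imsetP[x _ ->]; apply: eq_bigl => k.
by rewrite eq_porbit_mem porbit_sym.
Qed.

Lemma uniq_flatten_map (J K : eqType) (s : seq J) (L : J -> seq K) :
    uniq s -> (forall j, j \in s -> uniq (L j)) ->
    (forall i j k, i \in s -> j \in s -> k \in L i -> k \in L j -> i = j) ->
  uniq (flatten [seq L j | j <- s]).
Proof.
elim: s => //= j s IH /andP[js us] uL dL.
rewrite cat_uniq uL ?mem_head// IH//= ?andbT; last 2 first.
- by move=> i ins; apply: uL; rewrite inE ins orbT.
- by move=> i i' k h h'; apply: dL; rewrite inE ?h ?h' orbT.
apply/hasPn => k /flatten_mapP[i ins kL]; apply/negP => kLj.
by move: js; rewrite (dL j i k) ?mem_head ?inE ?ins ?orbT.
Qed.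

(** The product over [k] splits along the cycles of [sg]; distinct cycles share no index, so each is
    summed separately and gives a trace. *)
Lemma sum_cycles (sg : {perm 'I_n}) : (0 < N)%N ->
  \sum_(u : {ffun 'I_n -> 'I_N}) \prod_k M k (u k) (u (sg k))
  = \prod_(c in porbits sg) \tr (\prod_(i <- cycle_seq sg c) M i).
Proof.
move=> N_gt0; pose u0 (k : 'I_n) := Ordinal N_gt0.
pose L := flatten [seq cycle_seq sg c | c <- enum (porbits sg)].
have memL k : k \in L.
  apply/flatten_mapP; exists (porbit sg k); last first.
    by rewrite mem_cycle_seq ?porbit_id ?imset_f.
  by rewrite mem_enum imset_f.
have uL : uniq L.
  apply: uniq_flatten_map => [|c|c c' k]; first exact: enum_uniq.
    by rewrite mem_enum; exact: uniq_cycle_seq.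
  rewrite !mem_enum => cs cs'; rewrite !mem_cycle_seq//.
  case/imsetP: cs => x _ ->; case/imsetP: cs' => x' _ ->.
  by rewrite -!eq_porbit_mem => /eqP <- /eqP <-.
transitivity (isum L (fun u => \prod_k M k (u k) (u (sg k))) u0).
  rewrite -sum_ffun_isum//; apply: eq_bigl => u; apply/esym/forallP => k.
  by rewrite memL.
rewrite -[RHS]big_enum -(@isum_flatten _ _ _ _ _ (cycle_seq sg)
  (fun c u => \prod_(k in c) M k (u k) (u (sg k))) _ u0)//=.
- by apply: eq_isum => u; rewrite big_enum; exact: prod_porbits.
- move=> c v; rewrite mem_enum => cs.
  transitivity (isum (cycle_seq sg c)
      (fun u => \prod_(k <- cycle_seq sg c) M k (u k) (u (sg k))) v).
    apply: eq_isum => u; rewrite -big_enum /=; apply: perm_big.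
    apply: uniq_perm; rewrite ?enum_uniq ?uniq_cycle_seq// => k.
    by rewrite mem_enum mem_cycle_seq.
  case: (cycle_seqP cs) => x _ ->.
  have := uniq_traject_porbit sg x; have := iter_porbit sg x.
  case: #|_| (card_porbit_neq0 sg x) => // p _ /= sgx ux.
  have -> : (fun u : 'I_n -> 'I_N =>
      \prod_(k <- x :: traject sg (sg x) p) M k (u k) (u (sg k)))
      = path_weight x (traject sg (sg x) p) x.
    apply/funext => u; apply: path_weightE; first exact: fpath_traject.
    by rewrite last_traject -iterS.
  exact: isum_cycle_weight.
- move=> c v v'; rewrite mem_enum => cs h; apply: eq_bigr => k kc.
  rewrite !h ?mem_cycle_seq//.
  case/imsetP: cs kc => x _ ->; rewrite -!eq_porbit_mem.
  by rewrite (porbit_perm sg 1 k : porbit sg (sg k) = _).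
Qed.

End CycleSums.

(** * Numbers of cycles *)

Section PermutationCycles.
Variable T : finType.
Implicit Types (s t p : {perm T}).

Lemma porbit_step s x : porbit s (s x) = porbit s x.
Proof. exact: (porbit_perm s 1 x). Qed.

Lemma porbit_invariant s (A : {set T}) x y :
  (forall z, z \in A -> s z \in A) -> x \in A -> y \in porbit s x -> y \in A.
Proof.
move=> sA xA /porbitP[i ->].
by elim: i => [|i IH]; rewrite ?expg0 ?perm1// expgSr permM; exact: sA.
Qed.

(** The two products are conjugate by [s], which carries the cycles of one onto those of the
    other. *)
Lemma porbits_mulC s t : #|porbits (s * t)%g| = #|porbits (t * s)%g|.
Proof.
have step x i : (((t * s) ^+ i) (s x) = s (((s * t) ^+ i) x))%g.
  by elim: i x => [|i IH] x; rewrite ?expg0 ?perm1// !expgSr !permM IH.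
have orb x : porbit (t * s)%g (s x) = (s @: porbit (s * t)%g x)%SET.
  apply/setP => y; apply/porbitP/imsetP => [[i ->]|[z /porbitP[i ->] ->]].
    by exists (((s * t) ^+ i)%g x); rewrite ?step// mem_porbit.
  by exists i; rewrite step.
rewrite -(card_imset (mem (porbits (s * t)%g)) (imset_inj (@perm_inj _ s))).
congr #|pred_of_set _|; apply/setP => c.
apply/imsetP/imsetP => [[_ /imsetP[x _ ->] ->]|[y _ ->]].
  by exists (s x); rewrite ?orb.
exists (porbit (s * t)%g (s^-1%g y)); first exact: imset_f.
by rewrite -orb permKV.
Qed.

(** A transposition cuts a cycle containing both points, or joins two cycles. The version for
    multiplication on the other side is transported by inversion, which preserves cycles. *)
Lemma porbits_mul_tpermr s x y :
  (#|porbits (s * tperm x y)%g| + (x \notin porbit s y).*2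
   = #|porbits s| + (x != y))%N.
Proof.
have := porbits_mul_tperm s^-1%g x y.
rewrite /= porbitsV -[porbits (_ * s^-1)%g]porbitsV invMg invgK tpermV.
by rewrite porbitV.
Qed.

Definition is_pairing p := [forall x, (p x != x) && (p (p x) == x)].

Lemma pairing_neq p x : is_pairing p -> p x != x.
Proof. by move/forallP => /(_ x)/andP[]. Qed.

Lemma pairingK p : is_pairing p -> involutive p.
Proof. by move/forallP => h x; have /andP[_ /eqP] := h x. Qed.

Lemma involutionV p : involutive p -> (p^-1 = p)%g.
Proof. by move=> pp; apply/permP => x; rewrite -{1}(pp x) permK. Qed.

(** Takes the pair of [x] off an involution; the cycle bounds below use it to isolate the
    transpositions that matter. *)
Lemma tperm_mul_involution p x : involutive p ->
  [/\ involutive (tperm x (p x) * p)%g,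
      (tperm x (p x) * p)%g x = x, (tperm x (p x) * p)%g (p x) = p x
    & forall y, y != x -> y != p x -> (tperm x (p x) * p)%g y = p y].
Proof.
move=> pp; set q := (_ * _)%g.
have qx : q x = x by rewrite permM tpermL pp.
have qpx : q (p x) = p x by rewrite permM tpermR.
have qy y : y != x -> y != p x -> q y = p y.
  by move=> yx ypx; rewrite permM tpermD// eq_sym.
split=> // y; have [->|yx] := eqVneq y x; first by rewrite !qx.
have [->|ypx] := eqVneq y (p x); first by rewrite !qpx.
rewrite (qy y)// qy ?pp//; last by rewrite (inj_eq perm_inj).
by apply: contraNneq ypx => <-; rewrite pp.
Qed.

(** An involution moving m points is a product of m/2 transpositions. Involutions are used instead
    of pairings so that the bound applies to what remains of a pairing after some pairs are taken
    off. *)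
Lemma porbits_mul_involution s p : involutive p ->
  (#|porbits (s * p)%g|.*2 <= #|porbits s|.*2 + #|[set x | p x != x]%SET|)%N.
Proof.
have [m] := ubnP #|[set x | p x != x]%SET|; elim: m p s => // m IH p s.
case: m IH => [|m] IH.
  rewrite ltnS leqn0 cards_eq0 => /eqP p0 pp.
  have -> : p = 1%g.
    apply/permP => x; rewrite perm1; apply/eqP/negPn/negP => h.
    have : x \in [set x | p x != x]%SET by rewrite inE.
    by rewrite p0 inE.
  by rewrite mulg1 leq_addr.
rewrite ltnS => pm pp; have [p0|[x]] := set_0Vmem [set x | p x != x]%SET.
  by apply: IH; rewrite // p0 cards0.
rewrite inE => px; have [] := tperm_mul_involution x pp.
set q := (_ * p)%g => qq qx qpx qy.
have supp : [set y | q y != y]%SET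
    = ([set y | p y != y] :\ x :\ p x)%SET.
  apply/setP => y; rewrite !inE; have [->|ypx] /= := eqVneq y (p x).
    by rewrite qpx eqxx.
  by have [->|yx] /= := eqVneq y x; rewrite ?qx ?eqxx// qy.
have cardp : #|[set y | p y != y]%SET| = #|[set y | q y != y]%SET|.+2.
  rewrite supp (cardsD1 x) inE px /= add1n; congr _.+1.
  by rewrite (cardsD1 (p x)) !inE px (inj_eq perm_inj) px.
have -> : p = (tperm x (p x) * q)%g by rewrite /q mulgA tperm2 mul1g.
rewrite mulgA; apply: (leq_trans (IH _ _ _ qq)).
  by apply: leq_trans pm; rewrite cardp.
have -> : (tperm x (p x) * q)%g = p by rewrite /q mulgA tperm2 mul1g.
rewrite cardp !addnS -!addSn leq_add2r -doubleS leq_double.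
have := porbits_mul_tpermr s x (p x); rewrite eq_sym px addn1 => <-.
exact: leq_addr.
Qed.

Lemma card_pairing_porbit p x : is_pairing p -> #|porbit p x| = 2.
Proof.
move=> pp; have -> : porbit p x = [set x; p x]%SET.
  apply/setP => y; rewrite !inE; apply/idP/orP => [|[]/eqP->]; last 2 first.
  - exact: porbit_id.
  - by rewrite -eq_porbit_mem porbit_step.
  move=> yx; have : y \in [set x; p x]%SET.
    apply: porbit_invariant yx; last by rewrite !inE eqxx.
    by move=> z; rewrite !inE => /orP[]/eqP->; rewrite ?(pairingK pp) eqxx ?orbT.
  by rewrite !inE => /orP.
by rewrite cards2 eq_sym pairing_neq.
Qed.

Lemma trivIset_porbits s : finset.trivIset (porbits s).
Proof.
apply/finset.trivIsetP => _ _ /imsetP[x _ ->] /imsetP[y _ ->]; apply: contraNT.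
by case/pred0Pn => z /= /andP[]; rewrite -!eq_porbit_mem => /eqP <- /eqP <-.
Qed.

Lemma cover_porbits s : finset.cover (porbits s) = [set: T]%SET.
Proof.
apply/setP => x; rewrite inE; apply/bigcupP.
by exists (porbit s x); rewrite ?imset_f ?porbit_id.
Qed.

Lemma card_pairing_porbits p : is_pairing p -> #|porbits p|.*2 = #|T|.
Proof.
move=> pp; rewrite -[RHS]cardsT -muln2 -(cover_porbits p).
rewrite -(eqP (trivIset_porbits p)) (eq_bigr (fun => 2%N)) ?sum_nat_const//.
by move=> c /imsetP[x _ ->]; exact: card_pairing_porbit.
Qed.

Lemma pairing_even p : is_pairing p -> ~~ odd #|T|.
Proof. by move=> /card_pairing_porbits <-; rewrite odd_double. Qed.

End PermutationCycles.

(** * Crossing and non-crossing pairings composed with the long cycle *)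

Section NoncrossingPairings.
Variable n : nat.
Implicit Types (p : {perm 'I_n}).

Lemma gammaE (k : 'I_n) : gamma n k = (k.+1 %% n)%N :> nat.
Proof. by rewrite permE. Qed.

Lemma gamma_val (k : 'I_n) : (k.+1 < n)%N -> gamma n k = k.+1 :> nat.
Proof. by move=> kn; rewrite gammaE modn_small. Qed.

Lemma gamma_last (k : 'I_n) : k.+1 = n -> gamma n k = 0 :> nat.
Proof. by move=> kn; rewrite gammaE kn modnn. Qed.

Lemma gamma_onto (k : 'I_n) : (0 < k)%N -> exists2 l : 'I_n, gamma n l = k & k = l.+1 :> nat.
Proof.
move=> k0; have ln : (k.-1 < n)%N by apply: leq_ltn_trans (ltn_ord k); exact: leq_pred.
exists (Ordinal ln); last by rewrite /= prednK.
by apply: ord_inj; rewrite gamma_val /= prednK.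
Qed.

Lemma porbit_gamma (k l : 'I_n) : k \in porbit (gamma n) l.
Proof.
have n0 : (0 < n)%N by apply: leq_ltn_trans (ltn_ord k).
suff h (i : 'I_n) : porbit (gamma n) i = porbit (gamma n) (Ordinal n0).
  by rewrite -eq_porbit_mem !h.
case: i => i; elim: i => [|i IH] ilt; first by congr porbit; exact: ord_inj.
rewrite -(IH (ltnW ilt)) -[RHS]porbit_step; congr porbit.
by apply: ord_inj; rewrite gamma_val.
Qed.

Lemma card_porbits_gamma : (0 < n)%N -> #|porbits (gamma n)| = 1%N.
Proof.
move=> n0; apply/eqP/cards1P; exists (porbit (gamma n) (Ordinal n0)).
apply/setP => c; rewrite inE; apply/imsetP/eqP => [[x _ ->]|->]; last by eexists.
by apply/eqP; rewrite eq_porbit_mem porbit_gamma.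
Qed.

(** The conclusion is [false], whereas [noncrossing] asks that the two blocks coincide: a block
    containing a < b < c would have three elements. *)
Definition nc_perm p :=
  [forall a : 'I_n, forall b : 'I_n, forall c : 'I_n, forall d : 'I_n,
    [&& (a < b)%N, (b < c)%N, (c < d)%N, p a == c & p b == d] ==> false].

Lemma nc_permP p : nc_perm p ->
  forall a b : 'I_n, ~ [/\ (a < b)%N, (b < p a)%N & (p a < p b)%N].
Proof.
move=> pnc a b [h1 h2 h3].
move: pnc => /forallP/(_ a)/forallP/(_ b)/forallP/(_ (p a))/forallP/(_ (p b)).
by rewrite h1 h2 h3 !eqxx.
Qed.

(** Two crossing pairs waste two transpositions: the first cuts the long cycle in two and the second
    joins the pieces again. The other n/2 - 2 pairs add at most one cycle each to this single
    cycle. *)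
Lemma crossing_card_porbits p : is_pairing p -> ~~ nc_perm p ->
  (#|porbits (gamma n * p)%g|.*2.+2 <= n)%N.
Proof.
move=> pp; rewrite negb_forall => /existsP[a]; rewrite negb_forall => /existsP[b].
rewrite negb_forall => /existsP[c]; rewrite negb_forall => /existsP[d].
rewrite implybF negbK => /and5P[ab bc cd /eqP pa /eqP pb].
have n0 : (0 < n)%N by apply: leq_ltn_trans (ltn_ord a).
have [] := tperm_mul_involution a (pairingK pp); rewrite pa.
set q := (tperm _ _ * p)%g => qq qa qc qo.
have qb : q b = d by rewrite -pb; apply: qo; rewrite -val_eqE /= neq_ltn ?ab ?bc ?orbT.
have [] := tperm_mul_involution b qq; rewrite qb.
set r := (tperm _ _ * q)%g => rr rb rd ro.
have pE : p = (tperm a c * (tperm b d * r))%g.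
  by rewrite /r (mulgA (tperm b d)) tperm2 mul1g /q mulgA tperm2 mul1g.
have ra : r a = a.
  rewrite -[RHS]qa; apply: ro; rewrite -val_eqE /= neq_ltn ?ab//.
  by rewrite (ltn_trans ab)// (ltn_trans bc).
have rc : r c = c.
  by rewrite -[RHS]qc; apply: ro; rewrite -val_eqE /= neq_ltn ?bc ?cd ?orbT.
have suppr : (#|[set x | r x != x]%SET| + 4 <= n)%N.
  rewrite -[leqRHS]card_ord -(cardsC [set x | r x != x]%SET) leq_add2l.
  have u4 : uniq [:: a; b; c; d].
    rewrite /= !inE !negb_or -!val_eqE /= !neq_ltn ab bc cd (ltn_trans ab bc).
    by rewrite (ltn_trans bc cd) (ltn_trans ab (ltn_trans bc cd)).
  apply: (@leq_trans #|[:: a; b; c; d]|); first by rewrite (card_uniqP u4).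
  apply: subset_leq_card; apply/fintype.subsetP => x.
  by rewrite !inE negbK => /or4P[]/eqP->; rewrite ?ra ?rb ?rc ?rd.
have one : (#|porbits (gamma n * tperm a c * tperm b d)%g| <= 1)%N.
  have acn : a != c by rewrite -val_eqE neq_ltn (ltn_trans ab bc).
  have e1 := porbits_mul_tpermr (gamma n) a c.
  rewrite porbit_gamma acn card_porbits_gamma// addn0 in e1.
  have e2 := porbits_mul_tpermr (gamma n * tperm a c)%g b d.
  have bd : b != d by rewrite -val_eqE neq_ltn (ltn_trans bc cd).
  have db : d \notin porbit (gamma n * tperm a c)%g b.
    (* After the transposition of a and c, the point c - 1 is sent to a, so [a, c) is stable; it
       contains b but not d. *)
    apply/negP => db; have : d \in [set x : 'I_n | (a <= x < c)%N]%SET.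
      apply: porbit_invariant db; last by rewrite inE (ltnW ab) bc.
      move=> z; rewrite !inE => /andP[az zc]; rewrite permM.
      have gz : gamma n z = z.+1 :> nat by rewrite gamma_val// (leq_ltn_trans zc).
      have [zc'|zc'] := eqVneq (gamma n z) c.
        by rewrite zc' tpermR leqnn (ltn_trans ab bc).
      rewrite tpermD ?(eq_sym _ (gamma n z))//; last first.
        by rewrite -val_eqE /= gz neq_ltn ltnS az orbT.
      by rewrite ltn_neqAle zc' gz zc (leq_trans az) ?leqnSn.
    by rewrite inE ltnNge (ltnW cd) andbF.
  by rewrite e1 bd porbit_sym db in e2; rewrite -(leq_add2r 2) e2.
have := porbits_mul_involution (gamma n * tperm a c * tperm b d)%g rr.
rewrite -{1}(mulgA (gamma n)) -{1}(mulgA (gamma n)) -(mulgA (tperm a c)) -pE => h.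
apply: leq_trans suppr; rewrite -addn2 -[4%N]/(2 + 2)%N addnA leq_add2r.
apply: (leq_trans h); rewrite addnC leq_add2l.
by move: one; case: #|_| => [|[]].
Qed.

Section Noncrossing.
Variables (p : {perm 'I_n}) (pp : is_pairing p) (pnc : nc_perm p).
Let K := (gamma n * p)%g.

(** [gamma] moves [d, e) to (d, e]. Then p sends e back to d, and a point strictly inside whose
    partner lay outside would cross the pair (d, e). *)
Lemma nc_interval_invariant (d e z : 'I_n) : (d < e)%N -> p d = e ->
  (d <= z < e)%N -> (d <= K z < e)%N.
Proof.
move=> de pd /andP[dz ze]; rewrite /K permM.
have pe : p e = d by rewrite -pd pairingK.
have gz : gamma n z = z.+1 :> nat by rewrite gamma_val// (leq_ltn_trans ze).
have [->|gze] := eqVneq (gamma n z) e; first by rewrite pe leqnn.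
have dg : (d < gamma n z)%N by rewrite gz.
have ge : (gamma n z < e)%N by rewrite ltn_neqAle val_eqE gze gz.
move: (gamma n z) dg ge {gz gze} => y dy ye.
have yn : p y != e by rewrite -pd (inj_eq perm_inj) -val_eqE neq_ltn dy orbT.
apply/andP; split.
  rewrite leqNgt; apply/negP => yd; apply: (nc_permP pnc (a := p y) (b := d)).
  by rewrite pairingK// pd.
rewrite ltn_neqAle val_eqE yn leqNgt; apply/negP => ey.
by apply: (nc_permP pnc (a := d) (b := y)); rewrite pd.
Qed.

(* If (d, e) is a pair with d < e, the interval [d, e) is stable under K; hence a
   step K x <= x goes from the maximum of a cycle to its minimum. *)
Lemma nc_descent (x y : 'I_n) : (K x <= x)%N -> y \in porbit K x ->
  (K x <= y <= x)%N.
Proof.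
have inv (d e u v : 'I_n) : (d < e)%N -> p d = e -> (d <= u < e)%N ->
    v \in porbit K u -> (d <= v < e)%N.
  move=> de pd uI vu; suff: v \in [set z : 'I_n | (d <= z < e)%N]%SET by rewrite inE.
  apply: porbit_invariant vu; last by rewrite inE.
  by move=> z; rewrite !inE; exact: nc_interval_invariant.
move=> Kx yx; have [xn|xn] := ltnP x.+1 n.
  have gx := gamma_val xn; have Kxe : K x = p (gamma n x) by rewrite permM.
  have de : (K x < gamma n x)%N by rewrite gx.
  have := inv (K x) (gamma n x) x y de; rewrite Kxe pairingK// -Kxe gx.
  by rewrite Kx ltnSn ltnS; apply.
(* At x = n - 1 the rotation wraps to 0 and K x = p 0. A point y of the cycle below K x would lie in
   the stable interval [0, K x), and then so would x, against K x <= x. *)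
have {}xn : x.+1 = n by apply/eqP; rewrite eqn_leq xn ltn_ord.
rewrite [(y <= x)%N]/= -(ltnS y) xn ltn_ord andbT leqNgt; apply/negP => yK.
have g0 := gamma_last xn.
have de : (gamma n x < K x)%N by rewrite g0 (leq_ltn_trans _ yK).
have := inv (gamma n x) (K x) y x de; rewrite g0 yK porbit_sym => /(_ _ isT yx).
by rewrite permM => /(_ erefl)/andP[_]; rewrite -permM ltnNge Kx.
Qed.

(* Each cycle has exactly one descent, and the descents are n - 1 and the
   predecessors of the n/2 closing points of p. *)
Lemma nc_card_porbits : (0 < n)%N -> #|porbits K|.*2 = n.+2.
Proof.
move=> n0; pose D := [set x | (K x <= x)%N]%SET; pose z0 := Ordinal n0.
have DK x : x \in D -> (K x <= x)%N by rewrite inE.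
have -> : #|porbits K| = #|D|.
  rewrite -(card_in_imset (f := porbit K) (D := mem D)); last first.
    move=> x y xD yD /eqP; rewrite eq_porbit_mem => xy; apply/ord_inj/eqP.
    rewrite eqn_leq; have /andP[_ ->] := nc_descent (DK _ yD) xy.
    by move: xy; rewrite porbit_sym => /(nc_descent (DK _ xD))/andP[].
  congr #|pred_of_set _|; apply/setP => c; apply/imsetP/imsetP => [[x _ ->]|[x _ ->]].
    have xx := porbit_id K x.
    have [m mx hm] := @arg_maxnP _ x (mem (porbit K x)) val xx.
    exists m; last by apply/eqP; rewrite eq_porbit_mem porbit_sym.
    rewrite inE; apply: hm; move: mx => /=.
    by rewrite -!eq_porbit_mem porbit_step.
  by exists x.
have -> : #|D| = #|z0 |: [set e | (p e < e)%N]|%SET.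
  rewrite -(card_imset (mem D) (@perm_inj _ (gamma n))); congr #|pred_of_set _|.
  apply/setP => e; rewrite !inE; apply/imsetP/orP => [[x]|].
    rewrite inE permM => xD ->; have [xn|xn] := ltnP x.+1 n.
      by right; rewrite gamma_val.
    left; apply/eqP/ord_inj; rewrite gamma_last//.
    by apply/eqP; rewrite eqn_leq xn ltn_ord.
  case=> [/eqP->|pe].
    have xn : (n.-1 < n)%N by rewrite prednK.
    have gx : gamma n (Ordinal xn) = z0 by apply: ord_inj; rewrite gamma_last//= prednK.
    by exists (Ordinal xn) => //; rewrite inE /= -ltnS prednK.
  have [x gx ex] := gamma_onto (leq_ltn_trans (leq0n _) pe).
  by exists x => //; rewrite inE permM gx -ltnS -ex.
rewrite cardsU1 inE ltn0 /= add1n doubleS; congr _.+2.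
(* p exchanges the closing points with the opening ones, so each kind makes up half of the
   points. *)
have := cardsC [set e | (p e < e)%N]%SET; rewrite card_ord => hC.
rewrite -[RHS]hC -addnn; congr addn; rewrite -(card_imset _ (@perm_inj _ p)).
congr #|pred_of_set _|; apply/setP => e; rewrite [LHS]inE.
apply/idP/imsetP => [pe|[x]].
  by exists (p e); rewrite ?inE -?leqNgt pairingK// ltnW.
rewrite !inE -leqNgt => xp ->; rewrite pairingK// ltn_neqAle xp andbT eq_sym.
by rewrite (inj_eq (@ord_inj n)) pairing_neq.
Qed.

(** The listing starts at the minimum [x] of the cycle. A descent inside it would lead back to [x]
    and repeat an entry before the cycle is exhausted, so the listing increases. *)
Lemma nc_cycle_seq c : c \in porbits K -> cycle_seq K c = enum c.
Proof.
move=> cK; have mem_c := mem_cycle_seq cK; have u_c := uniq_cycle_seq cK.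
have irr : irreflexive (fun i j : 'I_n => (i < j)%N) by move=> i; rewrite ltnn.
have tr : transitive (fun i j : 'I_n => (i < j)%N) by move=> i j k; exact: ltn_trans.
have srt : sorted (fun i j : 'I_n => (i < j)%N) (enum c).
  rewrite {1}/enum_mem; apply: sorted_filter => //.
  suff: sorted ltn (map val (enum 'I_n)) by rewrite sorted_map enumT.
  by rewrite val_enum_ord; exact: iota_ltn_sorted.
apply: (irr_sorted_eq tr irr) => // [|k]; last by rewrite mem_enum.
move: cK mem_c u_c srt; rewrite /cycle_seq; case: (enum c) (mem_enum (mem c)) => //.
move=> x e emem cK mem_c u_c srt; apply/(sortedP x) => i.
rewrite size_traject => ic; rewrite !nth_traject// ?(ltn_trans _ ic)//.
set y := iter i K x; rewrite iterS -/y ltnNge; apply/negP => desc.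
have xc : x \in c by rewrite -emem mem_head.
have cE : c = porbit K x.
  by case/imsetP: cK xc => x0 _ ->; rewrite -eq_porbit_mem => /eqP ->.
have yx : y \in porbit K x by rewrite /y -permX mem_porbit.
have xy : x \in porbit K y by rewrite porbit_sym.
have /andP[Kyx _] := nc_descent desc xy.
have xK : (x <= K y)%N.
  have : K y \in x :: e.
    by rewrite emem cE; move: yx; rewrite -!eq_porbit_mem porbit_step.
  rewrite inE => /orP[/eqP-> //|h]; apply: ltnW.
  by move: srt => /= /(order_path_min tr)/allP; apply.
have Kx : K y = x by apply/ord_inj/eqP; rewrite eqn_leq Kyx.
have /uniqP := u_c => /(_ x 0%N i.+1); rewrite !inE size_traject nth_traject//.
  by rewrite nth_traject// iterS -/y Kx ic (leq_ltn_trans _ ic)// => /(_ isT isT erefl).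
exact: leq_ltn_trans ic.
Qed.

End Noncrossing.
End NoncrossingPairings.

(** * Pairings of the signed indices *)

Section SignedPairings.
Variable n : nat.
Implicit Types (rho : {perm signed n}) (r d : signed n) (p : {perm 'I_n}).

Lemma sdeltaE r : sdelta n r = (r.1, ~~ r.2).
Proof. by rewrite permE. Qed.

Lemma sdeltaK : involutive (sdelta n).
Proof. by move=> [k e]; rewrite !sdeltaE /= negbK. Qed.

Lemma sdelta_neq r : sdelta n r != r.
Proof. by case: r => k e; rewrite sdeltaE xpair_eqE /=; case: e; rewrite andbF. Qed.

Lemma sgammaE r : sgamma n r = if r.2 then r else (gamma n r.1, r.2).
Proof. by rewrite permE. Qed.

(** Comparing absolute values excludes fixed points and pairs (r, -r) at once. *)
Definition signed_pairing : {set {perm signed n}} :=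
  [set rho : {perm signed n} | [forall r, [&& (rho r).1 != r.1, rho (rho r) == r
     & rho (sdelta n r) == sdelta n (rho r)]]]%SET.

Definition sign_preserving rho := [forall r, (rho r).2 == r.2].

Lemma signed_pairingP rho : rho \in signed_pairing ->
  [/\ forall r, (rho r).1 != r.1, involutive rho
    & forall r, rho (sdelta n r) = sdelta n (rho r)].
Proof.
by rewrite inE => /forallP h; split=> r; have /and3P[h1 /eqP h2 /eqP h3] := h r.
Qed.

Lemma signed_pairing_pairing rho : rho \in signed_pairing -> is_pairing rho.
Proof.
case/signed_pairingP => h1 h2 _; apply/forallP => r; rewrite h2 eqxx andbT.
by apply: contraNneq (h1 r) => ->.
Qed.

(** Forgetting the signs turns [rho] into a pairing of [n]. *)
Lemma signed_pairing_even rho : rho \in signed_pairing -> ~~ odd n.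
Proof.
case/signed_pairingP => h1 h2 h3; pose f (k : 'I_n) := (rho (k, false)).1.
have rhoE k e : rho (k, e) = (f k, e (+) (rho (k, false)).2).
  case: e => /=; last by rewrite -surjective_pairing.
  have -> : (k, true) = sdelta n (k, false) by rewrite sdeltaE.
  by rewrite h3 sdeltaE.
have ff : involutive f.
  move=> k; rewrite {1}/f; have := h2 (k, false).
  by rewrite rhoE rhoE => -[].
have := @pairing_even _ (perm (inv_inj ff)); rewrite card_ord; apply.
apply/forallP => k; rewrite !permE ff eqxx andbT; exact: h1.
Qed.

(** The product whose cycles are counted in [NC2delta] is a cyclic rotation of [Kdelta_perm], so the
    counting condition can be read on the latter. *)
Lemma NC2deltaE rho : (rho \in NC2delta n) =
  [&& rho \in signed_pairing, ~~ sign_preserving rho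
    & #|porbits (Kdelta_perm rho)| == n].
Proof.
have -> : #|porbits (Kdelta_perm rho)|
    = #|porbits (rho * sdelta n * (sgamma n)^-1 * sdelta n * sgamma n)%g|.
  rewrite /Kdelta_perm (porbits_mulC _ (sgamma n)).
  by congr #|pred_of_set (porbits _)|; rewrite !mulgA.
rewrite inE /sign_preserving negb_forall; apply/idP/and3P.
  case/and5P => nodd /forallP inv opp cyc /andP[/forallP dl /forallP ne]; split=> //.
  rewrite inE; apply/forallP => r; have /andP[h1 h2] := inv r.
  rewrite h2 dl !andbT; apply: contraNneq (ne r) => h.
  move: (ne r) h1; case: (rho r) h => k e /= ->; rewrite sdeltaE.
  by case: r {h2} => l e'; rewrite !xpair_eqE /= eqxx /=; case: e; case: e'.
case=> rs opp cyc; rewrite (signed_pairing_even rs) cyc opp.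
have rp := signed_pairing_pairing rs; case/signed_pairingP: rs => h1 h2 h3.
rewrite [X in [&& _, X & _]]rp /=; apply/andP; split; apply/forallP => r.
  by rewrite h3.
by apply: contraNneq (h1 r) => ->; rewrite sdeltaE.
Qed.

(** This is gamma delta gamma^-1 delta: it rotates the positive indices forwards and the negative
    ones backwards, and preserves signs. *)
Definition signed_rot : {perm signed n} :=
  (sdelta n * (sgamma n)^-1 * sdelta n * sgamma n)%g.

Lemma signed_rotF k : signed_rot (k, false) = (gamma n k, false).
Proof.
rewrite !permM !sdeltaE /=.
have -> : ((sgamma n)^-1)%g (k, true) = (k, true).
  by apply: (canLR (permK _)); rewrite sgammaE.
by rewrite sgammaE.
Qed.

Lemma signed_rotT k : signed_rot (gamma n k, true) = (k, true).
Proof.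
rewrite !permM !sdeltaE /=.
have -> : ((sgamma n)^-1)%g (gamma n k, false) = (k, false).
  by apply: (canLR (permK _)); rewrite sgammaE.
by rewrite sgammaE.
Qed.

Lemma signed_rot_sign r : (signed_rot r).2 = r.2.
Proof.
case: r => k [|]; last by rewrite signed_rotF.
by rewrite -(permKV (gamma n) k) signed_rotT.
Qed.

Lemma card_porbits_signed_rot : (0 < n)%N -> (#|porbits signed_rot| <= 2)%N.
Proof.
move=> n0; pose z e : signed n := (Ordinal n0, e).
have orb r : porbit signed_rot r = porbit signed_rot (z r.2).
  case: r => -[k kn] e /=; elim: k kn => [|k IH] kn.
    by congr (porbit _ (_, _)); exact: ord_inj.
  rewrite -(IH (ltnW kn)); set l := Ordinal (ltnW kn).
  have -> : Ordinal kn = gamma n l by apply: ord_inj; rewrite gamma_val.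
  case: e {IH}; first by rewrite -(signed_rotT l) porbit_step.
  by rewrite -signed_rotF porbit_step.
apply: (@leq_trans #|[set porbit signed_rot (z false); porbit signed_rot (z true)]%SET|).
  apply: subset_leq_card; apply/fintype.subsetP => c /imsetP[r _ ->].
  by rewrite orb !inE; case: r.2; rewrite eqxx ?orbT.
by rewrite cards2; case: eqP.
Qed.

(** [rho] consists of n transpositions of 2n points. The one exchanging opposite signs leaves a
    single cycle, and the n - 1 others add at most one each. As the cycles counted here come in
    pairs, this bounds 2q. *)
Lemma opposite_sign_card_porbits rho :
  rho \in signed_pairing -> ~~ sign_preserving rho ->
  (#|porbits (Kdelta_perm rho)| <= n)%N.
Proof.
move=> rs; rewrite negb_forall => /existsP[r opp].
have rp := signed_pairing_pairing rs; have rK := pairingK rp.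
have -> : #|porbits (Kdelta_perm rho)| = #|porbits (signed_rot * rho)%g|.
  by rewrite [RHS]porbits_mulC /Kdelta_perm -!mulgA (porbits_mulC (sgamma n)) /signed_rot !mulgA.
have [] := tperm_mul_involution r rK; set q := (tperm _ _ * rho)%g => qq q1 q2 q3.
have rE : rho = (tperm r (rho r) * q)%g by rewrite /q mulgA tperm2 mul1g.
have rr : r != rho r by rewrite eq_sym pairing_neq.
have suppq : (#|[set x | q x != x]%SET| + 2 <= n.*2)%N.
  have <- : #|{: signed n}| = n.*2 by rewrite card_prod card_ord card_bool muln2.
  rewrite -(cardsC [set x | q x != x]%SET) leq_add2l.
  apply: (@leq_trans #|[set r; rho r]%SET|); first by rewrite cards2 rr.
  apply: subset_leq_card; apply/fintype.subsetP => x.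
  by rewrite !inE negbK => /orP[]/eqP->; rewrite ?q1 ?q2.
have := porbits_mul_tpermr signed_rot r (rho r).
rewrite rr; case: (boolP (_ \in _)) => [rin|_ /= e1].
  have : r \in [set x : signed n | x.2 == (rho r).2]%SET.
    apply: porbit_invariant rin; last by rewrite inE.
    by move=> x; rewrite !inE signed_rot_sign.
  by rewrite inE eq_sym (negbTE opp).
have one : (#|porbits (signed_rot * tperm r (rho r))%g| <= 1)%N.
  by rewrite -(leq_add2r 2) e1 addn1 ltnS card_porbits_signed_rot// (leq_ltn_trans _ (ltn_ord r.1)).
have := porbits_mul_involution (signed_rot * tperm r (rho r))%g qq.
rewrite -{1}mulgA -rE => h; rewrite -leq_double; apply: leq_trans suppq.
by apply: (leq_trans h); rewrite addnC leq_add2l; move: one; case: #|_| => [|[]].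
Qed.

End SignedPairings.

(** * The paired cycles attached to a signed pairing *)

Section CycleChoice.
Variables (n : nat) (rho : {perm signed n}) (rho_s : rho \in signed_pairing n).
Let K := Kdelta_perm rho.

(** Regard [d] as an edge carrying a matrix or its transpose. Then [sgamma n d] is the position of
    the index where it ends, [sgamma n (sdelta n d)] that where it starts, and K moves to the edge
    whose start is matched by [rho] with the end of [d]. *)
Lemma Kdelta_permE d :
  sgamma n (sdelta n (K d)) = sdelta n (rho (sgamma n d)).
Proof. by rewrite !permM sdeltaK permKV. Qed.

(** Equivalently delta K delta is the inverse of K: transposing every edge reverses the cycles. This
    is the source of the relation c' = delta c^-1 delta. *)
Lemma Kdelta_sdelta d : K (sdelta n (K d)) = sdelta n d.
Proof.
have [_ rr rd] := signed_pairingP rho_s.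
rewrite {1}/K /Kdelta_perm 4!permM Kdelta_permE rd rr sdeltaK permK.
by [].
Qed.

(* delta K^m is conjugate to delta or to delta rho, neither of which has a fixed
   point. *)
Lemma iter_Kdelta_neq m d : iter m K d != sdelta n d.
Proof.
have [rne _ _] := signed_pairingP rho_s.
have [k] := ubnP m; elim: k m d => // k IH [|[|m]] d mk.
- by rewrite eq_sym sdelta_neq.
- apply/eqP => /= /(congr1 (fun x => sgamma n (sdelta n x))).
  rewrite Kdelta_permE sdeltaK => h.
  by have := rne (sgamma n d); rewrite -{2}h sdeltaE eqxx.
(* Writing delta d as K (delta (K d)) and cancelling K reduces the exponent m + 2 at d to the
   exponent m at K d. *)
apply/eqP; rewrite iterS iterSr -Kdelta_sdelta => /perm_inj/eqP.
by apply/negP; apply: IH; rewrite ltnS in mk; exact: ltnW.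
Qed.

Lemma porbit_Kdelta_sdelta d : porbit K (sdelta n d) = (sdelta n @: porbit K d)%SET.
Proof.
have fwd d' x : x \in porbit K d' -> sdelta n x \in porbit K (sdelta n d').
  case/porbitP => i ->; rewrite -eq_porbit_mem permX; apply/eqP.
  by elim: i => //= i IH; rewrite -porbit_step Kdelta_sdelta.
apply/setP => x; apply/idP/imsetP => [xd|[y yd ->]]; last exact: fwd.
by exists (sdelta n x); rewrite ?sdeltaK// -(sdeltaK d); exact: fwd.
Qed.

Lemma porbit_Kdelta_neq d : porbit K (sdelta n d) != porbit K d.
Proof.
rewrite eq_porbit_mem; apply/negP => /porbitP[i /eqP].
by rewrite permX eq_sym (negbTE (iter_Kdelta_neq _ _)).
Qed.

(** The default value of [chosen_cycles] never occurs: c and delta c are distinct cycles, and taking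
    the one of smaller rank in an enumeration is a valid choice. *)
Lemma chosen_cyclesP : cycle_choice rho (chosen_cycles rho).
Proof.
rewrite /chosen_cycles; case: pickP => //= no.
pose ch := [set c in porbits K | (enum_rank c < enum_rank (sdelta n @: c)%SET)%N]%SET.
have := no ch; rewrite /cycle_choice => /negbT/negP[]; apply/andP; split.
  by apply/fintype.subsetP => c; rewrite inE => /andP[].
apply/forall_inP => _ /imsetP[d _ ->]; rewrite -porbit_Kdelta_sdelta !inE.
rewrite !imset_f//= -!porbit_Kdelta_sdelta sdeltaK.
have : enum_rank (porbit K d) != enum_rank (porbit K (sdelta n d)) :> nat.
  rewrite (inj_eq (@ord_inj _)) (inj_eq enum_rank_inj) eq_sym.
  exact: porbit_Kdelta_neq.
by case: ltngtP.
Qed.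

Lemma mem_cover_chosen d :
  (d \in finset.cover (chosen_cycles rho)) = (porbit K d \in chosen_cycles rho).
Proof.
have /andP[/fintype.subsetP sub _] := chosen_cyclesP.
apply/bigcupP/idP => [[c cch]|h]; last by exists (porbit K d); rewrite ?porbit_id.
by have /imsetP[x _ cE] := sub _ cch; rewrite {1}cE -eq_porbit_mem => /eqP ->; rewrite -cE.
Qed.

Lemma Kdelta_etaE k e :
  ((k, e) \in finset.cover (chosen_cycles rho)) = (e == Kdelta_eta rho k).
Proof.
rewrite /Kdelta_eta; case: e; first by case: (_ \in _).
have /andP[_ /forall_inP/(_ (porbit K (k, false)) (imset_f _ isT))] := chosen_cyclesP.
rewrite -porbit_Kdelta_sdelta sdeltaE /= -!mem_cover_chosen.
by case: (_ \in _); case: (_ \in _).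
Qed.

(** What a choice of cycles has to provide: one sign for each index, such that the selected edges
    are stable under K and K acts on them as [sg]. *)
Definition cycle_signs (sg : {perm 'I_n}) (eta : 'I_n -> bool) :=
  forall k, K (k, eta k) = (sg k, eta (sg k)).

Lemma Kdelta_cycle_signs : cycle_signs (Kdelta_sigma rho) (Kdelta_eta rho).
Proof.
have step k : let l := (K (k, Kdelta_eta rho k)).1 in
    K (k, Kdelta_eta rho k) = (l, Kdelta_eta rho l).
  have : K (k, Kdelta_eta rho k) \in finset.cover (chosen_cycles rho).
    by rewrite mem_cover_chosen porbit_step -mem_cover_chosen Kdelta_etaE.
  by case: (K _) => l e /=; rewrite Kdelta_etaE => /eqP ->.
have inj : injective (fun k => (K (k, Kdelta_eta rho k)).1).
  move=> k l h; suff /perm_inj [] : K (k, Kdelta_eta rho k) = K (l, Kdelta_eta rho l) by [].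
  by rewrite step [RHS]step /= h.
by move=> k; rewrite /Kdelta_sigma perm_of_funE// -step.
Qed.

Section Signs.
Variables (sg : {perm 'I_n}) (eta : 'I_n -> bool).
Hypothesis sgP : cycle_signs sg eta.

Lemma cycle_signsN k : K (sg k, ~~ eta (sg k)) = (k, ~~ eta k).
Proof. by have := Kdelta_sdelta (k, eta k); rewrite sgP !sdeltaE. Qed.

(** The edges split into those with sign [eta], on which K acts as [sg], and the opposite ones, on
    which it acts as the inverse of [sg]. *)
Lemma card_porbits_signs : #|porbits K| = #|porbits sg|.*2.
Proof.
pose f b k : signed n := (k, b (+) eta k).
have f_inj b : injective (f b) by move=> k l [].
have KF k : K (f false k) = f false (sg k) by exact: sgP.
have KT k : K (f true (sg k)) = f true k by exact: cycle_signsN.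
have orb b k : porbit K (f b k) = (f b @: porbit sg k)%SET.
  have itF i l : f b (iter i sg l) \in porbit K (f b l).
    elim: i => [|i]; first by rewrite porbit_id.
    rewrite iterS -!eq_porbit_mem => /eqP <-; apply/eqP.
    case: b {f_inj}; last by rewrite -KF porbit_step.
    by rewrite -[in RHS]KT porbit_step.
  apply/setP => d; apply/idP/imsetP => [dk|[l /porbitP[i ->] ->]]; last first.
    by rewrite permX itF.
  have : d \in (f b @: porbit sg k)%SET.
    apply: porbit_invariant dk; last by rewrite imset_f ?porbit_id.
    move=> _ /imsetP[l lk ->]; case: b {f_inj itF}.
      rewrite -(permKV sg l) KT imset_f//.
      by rewrite -eq_porbit_mem -porbit_step permKV eq_porbit_mem.
    by rewrite KF imset_f// -eq_porbit_mem porbit_step eq_porbit_mem.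
  by case/imsetP => l lk ->; exists l.
have split : porbits K = ((fun c : {set 'I_n} => f false @: c) @: porbits sg
    :|: (fun c : {set 'I_n} => f true @: c) @: porbits sg)%SET.
  apply/setP => c; rewrite inE; apply/imsetP/orP => [[[k e] _ ->]|].
    case: (eqVneq e (eta k)) => [->|ne]; [left|right]; apply/imsetP;
      exists (porbit sg k); rewrite ?imset_f// -orb /f //=.
    by congr (porbit _ (_, _)); case: e ne; case: (eta k).
  by case=> /imsetP[_ /imsetP[k _ ->] ->]; rewrite -orb; eexists.
rewrite split cardsU (card_imset _ (imset_inj (f_inj false))).
rewrite (card_imset _ (imset_inj (f_inj true))).
rewrite (_ : _ :&: _ = finset.set0)%SET ?cards0 ?subn0 ?addnn//.
apply/setP => c; rewrite !inE; apply/andP => -[/imsetP[_ /imsetP[k _ ->] ->]].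
case/imsetP => _ /imsetP[l _ ->] /setP/(_ (f false k)).
rewrite imset_f ?porbit_id// => /esym/imsetP[m _ [-> ]].
by case: (eta m).
Qed.

(** An admissible [J] is determined by the n indices u k where the edges (k, eta k) start, because
    [rho] identifies the end of each edge with the start of the next. The k-th factor is then an
    entry at (u k, u (sg k)) of A_k or of its transpose, and [sum_cycles] applies. *)
Lemma sum_signed_indices (C : comNzRingType) (N : nat) (A : 'I_n -> 'M[C]_N) :
  (0 < N)%N ->
  \sum_(J : {ffun signed n -> 'I_N} | [forall r, J (sdelta n (rho r)) == J r])
     \prod_k A k (J (k, true)) (J (gamma n k, false))
  = \prod_(c in porbits sg) \tr (\prod_(i <- cycle_seq sg c) eps_mx (A i) (eta i)).
Proof.
move=> N_gt0; rewrite -(sum_cycles _ _ N_gt0).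
(* An edge (k, e) carries A_k (e = false) or its transpose, and leaves the index
   attached to [start (k, e)]. *)
pose start d := sgamma n (sdelta n d).
pose h (u : {ffun 'I_n -> 'I_N}) : {ffun signed n -> 'I_N} := [ffun r =>
  let d := sdelta n ((sgamma n)^-1%g r) in
  if d.2 == eta d.1 then u d.1 else u (sg d.1)].
have hE u d : h u (start d) = if d.2 == eta d.1 then u d.1 else u (sg d.1).
  by rewrite ffunE /start permK sdeltaK.
have startF k : start (k, false) = (k, true) by rewrite /start sdeltaE sgammaE.
have startT k : start (k, true) = (gamma n k, false) by rewrite /start sdeltaE sgammaE.
have startK d : start (K d) = sdelta n (rho (sgamma n d)) by rewrite /start Kdelta_permE.
have startD d : start (sdelta n d) = sgamma n d by rewrite /start sdeltaK.
have nb (b : bool) : (~~ b == b) = false by case: b.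
have startP r : exists d, r = start d.
  by exists (sdelta n ((sgamma n)^-1%g r)); rewrite /start sdeltaK permKV.
rewrite (reindex_onto h (fun J => [ffun k => J (start (k, eta k))]))/=; last first.
  move=> J /forallP JP; apply/ffunP => r; have [[k e] ->] := startP r.
  rewrite hE /= !ffunE; have [->//|ne] := eqVneq e (eta k).
  rewrite -sgP startK (eqP (JP _)) -startD sdeltaE /=.
  by congr (J (start (_, _))); case: e ne; case: (eta k).
apply: eq_big => [u|u _].
  apply/andP; split; last first.
    by apply/eqP/ffunP => k; rewrite ffunE hE /= eqxx.
  apply/forallP => r; rewrite -(permKV (sgamma n) r).
  move: ((sgamma n)^-1%g r) => d; rewrite -startK -startD !hE; case: d => k e.
  rewrite sdeltaE /=; have [->|ne] := eqVneq e (eta k).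
    by rewrite sgP /= eqxx nb.
  have -> : e = ~~ eta k by case: e ne; case: (eta k).
  by rewrite negbK eqxx -(permKV sg k) cycle_signsN /= nb.
apply: eq_bigr => k _; rewrite -startF -startT !hE /= /eps_mx.
by case: (eta k); rewrite //= mxE.
Qed.

End Signs.
End CycleChoice.

(** * Signed pairings that come from a pairing of [n] *)

Section SignPreserving.
Variable n : nat.

Definition double_fun (p : {perm 'I_n}) (r : signed n) : signed n := (p r.1, r.2).

Lemma double_fun_inj p : injective (double_fun p).
Proof. by move=> [k e] [l f] [/perm_inj -> ->]. Qed.

Definition double_perm p : {perm signed n} := perm (@double_fun_inj p).

Lemma double_perm_signed p : is_pairing p -> double_perm p \in signed_pairing n.
Proof.
move=> pp; rewrite inE; apply/forallP => -[k e]; rewrite !permE /double_fun /=.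
by rewrite pairing_neq// pairingK// !eqxx.
Qed.

Lemma double_perm_preserving p : sign_preserving (double_perm p).
Proof. by apply/forallP => -[k e]; rewrite permE. Qed.

(** All signs may be taken positive, so no transpose occurs; as p is its own inverse, the cycles of
    p gamma are those of its Kreweras complement. *)
Lemma double_perm_signs p :
  cycle_signs (double_perm p) (gamma n * p)%g (fun => false).
Proof.
move=> k; apply: (@perm_inj _ (sdelta n)); apply: (@perm_inj _ (sgamma n)).
by rewrite Kdelta_permE !sdeltaE !sgammaE /= permE /= permM.
Qed.

Definition single_perm (rho : {perm signed n}) : {perm 'I_n} :=
  perm_of_fun (fun k => (rho (k, false)).1).

Lemma single_permE rho : rho \in signed_pairing n -> sign_preserving rho ->
  forall k e, rho (k, e) = (single_perm rho k, e).
Proof.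
move=> /signed_pairingP[h1 h2 h3] /forallP sp k e.
have rF l : rho (l, false) = ((rho (l, false)).1, false).
  by rewrite [LHS]surjective_pairing (eqP (sp (l, false))).
have inj : injective (fun l => (rho (l, false)).1).
  move=> l m h; suff /perm_inj[] : rho (l, false) = rho (m, false) by [].
  by rewrite rF h -rF.
rewrite perm_of_funE//; case: e => //; have -> : (k, true) = sdelta n (k, false).
  by rewrite sdeltaE.
by rewrite h3 rF sdeltaE.
Qed.

Lemma single_perm_pairing rho : rho \in signed_pairing n -> sign_preserving rho ->
  is_pairing (single_perm rho).
Proof.
move=> rs sp; have E := single_permE rs sp.
have [h1 h2 h3] := signed_pairingP rs; apply/forallP => k.
have := h1 (k, false); rewrite E /= => ->.
by have := h2 (k, false); rewrite !E => -[->] /=.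
Qed.

Lemma double_permK p : single_perm (double_perm p) = p.
Proof.
apply/permP => k; rewrite perm_of_funE ?permE// => l m.
by rewrite !permE; exact: perm_inj.
Qed.

Lemma single_permK rho : rho \in signed_pairing n -> sign_preserving rho ->
  double_perm (single_perm rho) = rho.
Proof.
by move=> rs sp; apply/permP => -[k e]; rewrite permE (single_permE rs sp).
Qed.

Lemma sum_sign_preserving (V : nmodType) (F : {perm signed n} -> V) :
  \sum_(rho in signed_pairing n | sign_preserving rho) F rho
  = \sum_(p : {perm 'I_n} | is_pairing p) F (double_perm p).
Proof.
rewrite (reindex_onto double_perm single_perm) /=; last first.
  by move=> rho /andP[]; exact: single_permK.
apply: eq_bigl => p; rewrite double_permK eqxx andbT double_perm_preserving andbT.
apply/idP/idP => [h|]; last exact: double_perm_signed.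
by rewrite -(double_permK p); apply: single_perm_pairing; rewrite ?double_perm_preserving.
Qed.

End SignPreserving.

(** * Gaussian moments and independence *)

Section GaussianMoments.
Variable R : realType.
Let mu := @lebesgue_measure R.
Let p (x : R) := normal_pdf 0 1 x.

Let pE x : p x = normal_peak 1 * expR (- (2^-1 * x ^+ 2)).
Proof.
rewrite /p normal_pdfE ?oner_neq0// /normal_fun subr0 expr1n mulNr; congr (_ * expR (- _)).
by rewrite mulrC.
Qed.

(** exp(-x^2/2) is the square of exp(-x^2/4). One factor absorbs the monomial; the other is, up to a
    constant, the density of variance 2, whose integrability and boundedness then give those of the
    monomials times p. *)
Lemma monomial_normal_bound k :
  exists2 C : R, 0 <= C & forall x, `|x| ^+ k * p x <= C * normal_pdf 0 (Num.sqrt 2) x.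
Proof.
have s0 : Num.sqrt 2 != 0 :> R by rewrite gt_eqF// sqrtr_gt0.
have qE x : normal_pdf 0 (Num.sqrt 2) x
    = normal_peak (Num.sqrt 2) * expR (- (4^-1 * x ^+ 2)) :> R.
  rewrite normal_pdfE// /normal_fun subr0 mulNr sqr_sqrtr//; congr (_ * expR (- _)).
  by rewrite mulrC -mulr_natr; congr (_^-1 * _); rewrite -natrM.
have q0 : 0 < normal_peak (Num.sqrt 2) :> R by exact: normal_peak_gt0.
(* With y = x^2/4, the exponential series gives y^(k+1) <= (k+1)! e^y, which bounds |x|^(2k+2) and
   hence |x|^k for |x| > 1; the summand 1 covers |x| <= 1. *)
pose c : R := 1 + 4 ^+ k.+1 * k.+1`!%:R.
have c0 : 0 <= c by rewrite addr_ge0// mulr_ge0// exprn_ge0.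
exists (normal_peak 1 * c / normal_peak (Num.sqrt 2)) => [|x].
  by rewrite !mulr_ge0// ?normal_peak_ge0// invr_ge0 ltW.
set y := 4^-1 * x ^+ 2; have y0 : 0 <= y by rewrite mulr_ge0// sqr_ge0.
have xy : x ^+ 2 = 4 * y by rewrite /y; lra.
suff key : `|x| ^+ k <= c * expR y.
  have -> : p x = normal_peak 1 * ((expR y)^-1 * (expR y)^-1).
    by rewrite pE -!expRN -expRD; congr (_ * expR _); rewrite /y; lra.
  rewrite qE expRN -/y; have e0 : 0 < expR y := expR_gt0 y.
  have -> : normal_peak 1 * c / normal_peak (Num.sqrt 2)
      * (normal_peak (Num.sqrt 2) * (expR y)^-1)
      = (c * expR y) * (normal_peak 1 * ((expR y)^-1 * (expR y)^-1)) :> R.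
    by field; rewrite !gt_eqF.
  by apply: ler_wpM2r => //; rewrite !mulr_ge0 ?normal_peak_ge0// invr_ge0 ltW.
have [x1|x1] := leP `|x| 1.
  apply: (@le_trans _ _ 1); first exact: exprn_ile1.
  rewrite (le_trans _ (ler_peMl _ _)) ?expR_ge0//.
    by rewrite -expR0 ler_expR.
  by rewrite lerDl mulr_ge0// exprn_ge0.
apply: (@le_trans _ _ (`|x| ^+ (2 * k.+1))).
  apply: ler_weXn2l; first exact: ltW.
  by rewrite (leq_trans (leqnSn k))// leq_pmull.
rewrite exprM real_normK ?num_real// xy exprMn.
have := expR_ge1Dxn k y0; set e := expR y => he.
have f0 : 0 < k.+1`!%:R :> R by rewrite ltr0n fact_gt0.
have {}he : y ^+ k.+1 <= k.+1`!%:R * e.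
  rewrite mulrC -ler_pdivrMr//; apply: le_trans he.
  by rewrite lerDr.
rewrite /c mulrDl mul1r; apply: (@le_trans _ _ (4 ^+ k.+1 * k.+1`!%:R * e)); last first.
  by rewrite lerDr expR_ge0.
by rewrite -mulrA ler_wpM2l// exprn_ge0.
Qed.

Let measurable_monomial k : measurable_fun setT (fun x : R => x ^+ k * p x).
Proof.
by apply: measurable_funM; [exact: exprn_measurable|exact: measurable_normal_pdf].
Qed.

Lemma integrable_monomial_normal k :
  mu.-integrable setT (fun x => (x ^+ k * p x)%:E).
Proof.
have [C C0 hC] := monomial_normal_bound k.
apply: (@le_integrable _ _ _ mu _ measurableT _
  (fun x => (C * normal_pdf 0 (Num.sqrt 2) x)%:E)) => //.
- by apply: measurableT_comp; [exact: EFin_measurable|exact: measurable_monomial].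
- move=> x _; rewrite !abse_EFin lee_fin normrM normrX (ger0_norm (normal_pdf_ge0 _ _ _)).
  by rewrite [leRHS]ger0_norm ?mulr_ge0 ?normal_pdf_ge0//; exact: hC.
under eq_fun do rewrite EFinM.
by apply: integrableZl => //; exact: integrable_normal_pdf.
Qed.

Definition gaussian_moment k : R := fine (\int[mu]_x (x ^+ k * p x)%:E)%E.

Lemma gaussian_moment0 : gaussian_moment 0 = 1.
Proof.
rewrite /gaussian_moment; under eq_integral do rewrite expr0 mul1r.
by rewrite integral_normal_pdf.
Qed.

(** Since p' = -x p, [F k] is a primitive of [f k], and the moment recursion says that the integral
    of [f k] vanishes. At k = 0 the coefficient of the truncated power is 0. *)
Let F k (x : R) := - (x ^+ k * p x).
Let f k (x : R) := x ^+ k.+1 * p x - k%:R * (x ^+ k.-1 * p x).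

Let is_derive_F k (x : R) : is_derive x 1 (F k) (f k x).
Proof.
have dX m : is_derive x 1 (fun z : R => z ^+ m) (m%:R * x ^+ m.-1).
  have -> : (fun z : R => z ^+ m) = (id : R -> R) ^+ m by rewrite exprfctE.
  by apply: is_derive_eq; rewrite /= scaler1.
have dq : is_derive x 1 (fun z : R => - (2^-1 * z ^+ 2)) (- x).
  have h := is_deriveN (is_deriveM (is_derive_cst (2^-1 : R) x 1) (dX 2)).
  by apply: is_derive_eq h _; rewrite /= /GRing.scale /= expr1; lra.
have dp : is_derive x 1 p (- (x * p x)).
  have -> : p = (fun z : R => normal_peak 1 * expR (- (2^-1 * z ^+ 2))).
    by apply/funext => z; rewrite pE.
  have h := is_deriveM (is_derive_cst (normal_peak 1 : R) x 1)
    (is_derive1_comp (is_derive_expR _) dq).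
  by apply: is_derive_eq h _; rewrite /= /GRing.scale /=; ring.
have h := is_deriveN (is_deriveM (dX k) dp).
apply: is_derive_eq h _.
by rewrite /f /GRing.scale /= exprS; ring.
Qed.

Let continuous_monomial k : continuous (fun x : R => x ^+ k * p x).
Proof.
move=> x; apply: cvgM; first exact: exprn_continuous.
exact: continuous_normal_pdf (oner_neq0 _) x.
Qed.

Let continuous_f k : continuous (f k).
Proof.
move=> x; apply: cvgB; first exact: continuous_monomial.
by apply: cvgM; [exact: cvg_cst|exact: continuous_monomial].
Qed.

Let integrable_f k : mu.-integrable setT (EFin \o f k).
Proof.
have -> : EFin \o f k = ((fun x => (x ^+ k.+1 * p x)%:E) \-
    (fun x => k%:R%:E * (x ^+ k.-1 * p x)%:E))%E.
  by apply/funext => x; rewrite /= /f EFinB EFinM.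
apply: integrableB => //; first exact: integrable_monomial_normal.
by apply: integrableZl => //; exact: integrable_monomial_normal.
Qed.

Let integral_f k : (\int[mu]_x (f k x)%:E
  = (gaussian_moment k.+1 - k%:R * gaussian_moment k.-1)%:E)%E.
Proof.
have im m := integrable_monomial_normal m.
transitivity (\int[mu]_x ((x ^+ k.+1 * p x)%:E - k%:R%:E * (x ^+ k.-1 * p x)%:E))%E.
  by apply: eq_integral => x _; rewrite /f EFinB EFinM.
rewrite integralB//=; last by apply: integrableZl.
rewrite integralZl// /gaussian_moment EFinB EFinM !fineK//.
- exact: integrable_fin_num.
- exact: integrable_fin_num.
Qed.

Let itv_sym m : set R := `[- m.+1%:R, m.+1%:R]%classic.

Let integral_f_itv k m :
  (\int[mu]_(x in itv_sym m) (f k x)%:E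
   = (F k m.+1%:R - F k (- m.+1%:R))%:E)%E.
Proof.
have cF : continuous (F k).
  by move=> x; apply: cvgN; exact: continuous_monomial.
rewrite /itv_sym EFinB; apply: continuous_FTC2.
- by rewrite gtrN.
- exact/continuous_subspaceT/continuous_f.
- split=> [x _||]; first by apply: ex_derive; exact: is_derive_F.
  + exact/cvg_at_right_filter/cF.
  + exact/cvg_at_left_filter/cF.
- by move=> x _; rewrite derive1E; apply: derive_val; exact: is_derive_F.
Qed.

Let cvg_integral_itv k :
  (\int[mu]_(x in itv_sym m) (f k x)%:E @[m --> \oo]
   --> \int[mu]_x (f k x)%:E)%E.
Proof.
under eq_fun do rewrite integral_mkcond.
have [] // := @dominated_convergence _ _ _ mu setT measurableT
  (fun m => (EFin \o f k) \_ (itv_sym m)) (EFin \o f k) (abse \o (EFin \o f k)).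
- move=> m; have mI : measurable (itv_sym m) by exact: measurable_itv.
  apply/(measurable_restrictT _ mI)/measurable_funTS.
  exact: measurable_int (integrable_f k).
- exact: measurable_int (integrable_f k).
- apply: aeW => x _; apply: cvg_near_cst; near=> m.
  rewrite patchE ifT// inE /itv_sym /= in_itv /= -ler_norml.
  near: m; have [M hM] : exists M : nat, `|x| <= M%:R.
    by exists (Num.truncn `|x|).+1; exact/ltW/truncnS_gt.
  exists M => // m /= Mm; apply: (le_trans hM); rewrite ler_nat.
  exact: leq_trans Mm _.
- exact: integrable_abse (integrable_f k).
- apply: aeW => x m _; rewrite patchE; case: ifP => //= _.
  by rewrite normr0 lee_fin normr_ge0.
Unshelve. all: by end_near. Qed.

(** The bound in degree k + 1 says that |x|^(k+1) p x is bounded, so the boundary terms are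
    O(1/|x|). *)
Let cvg_F k : F k m.+1%:R - F k (- m.+1%:R) @[m --> \oo] --> (0 : R).
Proof.
have [C C0 hC] := monomial_normal_bound k.+1.
pose D := C * normal_peak (Num.sqrt 2); have D0 : 0 <= D.
  by rewrite mulr_ge0 ?normal_peak_ge0.
have bnd (x : R) : 0 < x -> `|F k x - F k (- x)| <= (2 * D) * x^-1.
  move=> x0; have key z : `|z| = x -> `|F k z| <= D * x^-1.
    move=> zx; rewrite normrN normrM normrX zx (ger0_norm (normal_pdf_ge0 _ _ _)).
    rewrite ler_pdivlMr// mulrAC -exprSr -{1}zx; apply: (le_trans (hC z)).
    apply: ler_wpM2l => //; apply: normal_pdf_ub.
    by rewrite gt_eqF// sqrtr_gt0.
  apply: (le_trans (ler_normB _ _)); rewrite -mulrA mulr_natl mulr2n.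
  by apply: lerD; apply: key; rewrite ?normrN gtr0_norm.
apply: norm_cvg0; apply: (@squeeze_cvgr _ _ _ _ (fun=> 0) (fun m => (2 * D) * harmonic m)).
- by apply: nearW => m; rewrite normr_ge0 /=; apply: bnd.
- exact: cvg_cst.
- rewrite -[X in _ --> X](mulr0 (2 * D)).
  by apply: cvgM; [exact: cvg_cst|exact: cvg_harmonic].
Qed.

Lemma gaussian_momentS k : gaussian_moment k.+1 = k%:R * gaussian_moment k.-1.
Proof.
have h : (\int[mu]_x (f k x)%:E = 0%:E)%E.
  rewrite -(cvg_lim (@ereal_hausdorff R) (@cvg_integral_itv k)).
  apply: (cvg_lim (@ereal_hausdorff R)).
  under eq_fun do rewrite integral_f_itv.
  by apply: cvg_EFin; [exact: nearW|exact: cvg_F].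
move: h; rewrite integral_f => -[] /eqP.
by rewrite subr_eq0 => /eqP.
Qed.

End GaussianMoments.

(** * Integration against a weighted law *)

Section Weight.
Context {d1 d2 : measure_display} {T : measurableType d1} {U : measurableType d2}.
Context {R : realType}.
Variables (mu : {measure set T -> \bar R}) (nu : {measure set U -> \bar R}).
Variables (W : T -> R) (X : T -> U).
Hypotheses (W0 : forall t, 0 <= W t) (mW : measurable_fun setT W).
Hypothesis mX : measurable_fun setT X.
Hypothesis WX : forall D, measurable D ->
  (\int[mu]_t (W t * \1_D (X t))%:E = nu D)%E.

Import HBNNSimple.
Local Open Scope ereal_scope.

(** [WX] is the identity for indicators; simple functions and monotone convergence extend it. It
    serves with [W] a product of the other factors, for independence, and with [W] the normal
    density, for the law of a Gaussian variable. *)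
Lemma ge0_integral_weight (f : U -> R) : (forall u, 0 <= f u)%R ->
  measurable_fun setT f ->
  \int[mu]_t (W t * f (X t))%:E = \int[nu]_u (f u)%:E.
Proof.
move=> f0 mf; have mf' : measurable_fun setT (EFin \o f) by exact/measurable_EFinP.
pose h := nnsfun_approx measurableT mf'.
have hf u : (EFin \o h n) u @[n --> \oo] --> (f u)%:E.
  by apply: (cvg_nnsfun_approx measurableT mf') => // v _; rewrite lee_fin.
have ndh u m n : (m <= n)%O -> (h m u <= h n u)%R.
  by move=> mn; exact/lefP/nd_nnsfun_approx.
have mh n : measurable_fun setT (h n) by [].
have -> : \int[nu]_u (f u)%:E = lim (\int[nu]_u (EFin \o h n) u @[n --> \oo]).
  under eq_integral => u _ do rewrite -(cvg_lim (@ereal_hausdorff R) (hf u)).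
  apply: monotone_convergence => //.
  - by move=> n; exact/measurable_EFinP.
  - by move=> n u _; rewrite /= lee_fin.
  - by move=> u _ m n mn; rewrite lee_fin; exact: ndh.
have -> : \int[mu]_t (W t * f (X t))%:E
    = lim (\int[mu]_t ((W t)%:E * (EFin \o h n) (X t)) @[n --> \oo]).
  have hW t : (W t)%:E * (EFin \o h n) (X t) @[n --> \oo] --> (W t * f (X t))%:E.
    by rewrite EFinM; apply: cvgeZl => //; exact: hf.
  under eq_integral => t _ do rewrite -(cvg_lim (@ereal_hausdorff R) (hW t)).
  apply: monotone_convergence => //.
  - move=> n; apply: emeasurable_funM; first exact/measurable_EFinP.
    by apply/measurable_EFinP; apply: measurableT_comp.
  - by move=> n t _; rewrite /= mule_ge0 ?lee_fin.
  - by move=> t _ m n mn; apply: lee_wpmul2l; rewrite lee_fin//; exact: ndh.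
suff suf n : \int[mu]_t ((W t)%:E * (EFin \o h n) (X t)) = \int[nu]_u (EFin \o h n) u.
  by under eq_fun do rewrite suf.
have mhr r : measurable (h n @^-1` [set r]) by rewrite -[X in measurable X]setTI; exact: mh.
have mWr r : measurable_fun setT (fun t => (W t * \1_(h n @^-1` [set r]) (X t))%:E).
  apply/measurable_EFinP/measurable_funM => //; apply: measurableT_comp => //.
have hE u : (EFin \o h n) u
    = \sum_(r \in range (h n)) (r%:E * (\1_(h n @^-1` [set r]) u)%:E).
  by rewrite /= fimfunE -fsumEFin//; apply: eq_fsbigr => r _; rewrite EFinM.
transitivity (\sum_(r \in range (h n)) r%:E * nu (h n @^-1` [set r])); last first.
  under [RHS]eq_integral do rewrite hE.
  rewrite ge0_integral_fsum//; last 2 first.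
  - by move=> r; apply/measurable_EFinP/measurable_funM.
  - by move=> r u _; exact: nnfun_muleindic_ge0.
  apply: eq_fsbigr => r; rewrite inE => -[u _ <-].
  rewrite ge0_integralZl//; last 2 first.
  - by apply/measurable_EFinP.
  - by rewrite lee_fin.
  by rewrite integral_indic// setIT.
transitivity (\int[mu]_t \sum_(r \in range (h n))
    (r%:E * (W t * \1_(h n @^-1` [set r]) (X t))%:E)).
  apply: eq_integral => t _; rewrite hE ge0_mule_fsumr; last first.
    by move=> r; exact: nnfun_muleindic_ge0.
  by apply: eq_fsbigr => r _; rewrite EFinM muleCA.
have r0 r t : 0 <= r%:E * (W t * \1_(h n @^-1` [set r]) (X t))%:E.
  by rewrite EFinM muleCA mule_ge0 ?lee_fin//; exact: nnfun_muleindic_ge0.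
rewrite ge0_integral_fsum//; last by move=> r; apply: emeasurable_funM.
apply: eq_fsbigr => r; rewrite inE => -[u _ <-].
rewrite ge0_integralZl// ?WX//; last by rewrite lee_fin.
by move=> t _; rewrite lee_fin mulr_ge0.
Qed.

End Weight.

Section Expectation.
Context {d : measure_display} {Om : measurableType d} {R : realType}.
Variable P : probability Om R.
Implicit Types (Y Z : Om -> R).

Definition rexp Y : R := fine (\int[P]_w (Y w)%:E)%E.

Definition has_rexp Y : Prop := P.-integrable setT (EFin \o Y).

Lemma rexpE Y : has_rexp Y -> (\int[P]_w (Y w)%:E = (rexp Y)%:E)%E.
Proof. by move=> iY; rewrite fineK//; exact: integrable_fin_num. Qed.

Lemma has_rexpZ c Y : has_rexp Y -> has_rexp (fun w => c * Y w).
Proof.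
move=> iY; have := @integrableZl _ _ _ P setT measurableT c _ iY.
by apply: eq_integrable => // w _; rewrite /= EFinM.
Qed.

Lemma rexpZ c Y : has_rexp Y -> rexp (fun w => c * Y w) = c * rexp Y.
Proof.
move=> iY; rewrite {1}/rexp; under eq_integral do rewrite EFinM.
by rewrite integralZl// rexpE.
Qed.

Lemma has_rexp_sum (I : finType) (Y : I -> Om -> R) :
  (forall i, has_rexp (Y i)) -> has_rexp (fun w => \sum_i Y i w).
Proof.
move=> iY; have := @integrable_sum _ _ _ P setT measurableT _ (index_enum I) predT _
  (fun i _ => iY i).
by apply: eq_integrable => // w _; rewrite /= -sumEFin.
Qed.

Lemma rexp_sum (I : finType) (Y : I -> Om -> R) :
  (forall i, has_rexp (Y i)) -> rexp (fun w => \sum_i Y i w) = \sum_i rexp (Y i).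
Proof.
move=> iY; rewrite {1}/rexp; under eq_integral do rewrite -sumEFin.
rewrite (@integral_sum _ _ _ P setT measurableT _ (fun i => EFin \o Y i) iY).
by under eq_bigr do rewrite rexpE//; rewrite sumEFin.
Qed.

Lemma has_rexp_ge0 Y : measurable_fun setT Y -> (forall w, 0 <= Y w) ->
  (\int[P]_w (Y w)%:E < +oo)%E -> has_rexp Y.
Proof.
move=> mY Y0 Yoo; apply/integrableP; split; first exact/measurable_EFinP.
by under eq_integral => w _ do rewrite /= ger0_norm//.
Qed.

End Expectation.

(** * Expectation of a product of independent variables *)

Section Independence.
Context {d : measure_display} {Om : measurableType d} {R : realType}.
Variables (P : probability Om R) (I : finType) (X : I -> {RV P >-> R}).
Hypothesis indX : mutually_independent X.
Implicit Types (f : I -> R -> R).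

Let mX i : measurable_fun setT (X i). Proof. by []. Qed.

Let measurable_prod_RV f (Q : pred I) : (forall i, measurable_fun setT (f i)) ->
  measurable_fun setT (fun w => \prod_(i | Q i) f i (X i w)).
Proof.
move=> mf; under eq_fun do rewrite -big_filter.
by apply: measurable_prod => i _; apply: measurableT_comp.
Qed.

Let integral_indic_RV i (D : set R) : measurable D ->
  (\int[P]_w (\1_D (X i w))%:E = P (X i @^-1` D))%E.
Proof.
move=> mD; have mXD : measurable (X i @^-1` D).
  by rewrite -[X in measurable X]setTI; exact: mX.
by rewrite -[in RHS](setIT (X i @^-1` D)) -integral_indic.
Qed.

(* For i outside s the factor f i is an indicator; the case s = set0 is the
   definition of independence, and ge0_integral_weight replaces the indicators by
   general functions one at a time. *)
Lemma independent_integral_prod_ge0 (s : {set I}) f :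
  (forall i x, 0 <= f i x) -> (forall i, measurable_fun setT (f i)) ->
  (forall i, \int[P]_w (f i (X i w))%:E < +oo)%E ->
  (forall i, i \notin s -> exists2 D, measurable D & f i = \1_D) ->
  (\int[P]_w (\prod_i f i (X i w))%:E
   = (\prod_i rexp P (fun w => f i (X i w)))%:E)%E.
Proof.
have [m] := ubnP #|s|; elim: m s f => // m IH s f sm f0 mf foo fD.
have [s0|[i0 i0s]] := set_0Vmem s.
  have {}fD i : exists2 D, measurable D & f i = \1_D by apply: fD; rewrite s0 inE.
  pose D i := xget set0 [set E | measurable E /\ f i = \1_E].
  have DP i : measurable (D i) /\ f i = \1_(D i).
    rewrite /D; case: xgetP => [E _ //|no]; case: (fD i) => E mE fE.
    by exfalso; exact: (no E).
  have := indX (J := [set: I]%SET) (fun i _ => (DP i).1).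
  have -> : \bigcap_(i in [set` [set: I]%SET]) (X i @^-1` D i)
      = [set w | forall i, D i (X i w)].
    by apply/seteqP; split=> w /= h i; [apply: h; rewrite /= inE|move=> _; exact: h].
  move=> ind; transitivity (P [set w | forall i, D i (X i w)]).
    transitivity (\int[P]_w (\1_[set w | forall i, D i (X i w)] w)%:E)%E.
      apply: eq_integral => w _; congr (_%:E); rewrite indicE.
      case: (pselect (forall i, D i (X i w))) => h.
        rewrite mem_set// big1// => i _; rewrite (DP i).2 indicE mem_set//; exact: h.
      rewrite memNset//; case/existsNP: h => i h.
      by rewrite (bigD1 i)//= (DP i).2 indicE memNset// mul0r.
    rewrite integral_indic// ?setIT//.
    have -> : [set w | forall i, D i (X i w)]
        = \bigcap_(i in [set: I]) (X i @^-1` D i).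
      by apply/seteqP; split=> w /= h i; [move=> _; exact: h|exact: h].
    apply: fin_bigcap_measurable; first exact: finite_finset.
    move=> i _; rewrite -[X in measurable X]setTI; apply: mX => //; exact: (DP i).1.
  rewrite ind -prodEFin; apply: eq_big => [i|i _]; first by rewrite inE.
  rewrite (DP i).2 /rexp integral_indic_RV; last exact: (DP i).1.
  by rewrite fineK// fin_num_measure// -[X in measurable X]setTI; apply: mX => //; exact: (DP i).1.
pose W w := \prod_(i | i != i0) f i (X i w).
pose c := \prod_(i | i != i0) rexp P (fun w => f i (X i w)).
have e0 i : 0 <= rexp P (fun w => f i (X i w)).
  by apply: fine_ge0; apply: integral_ge0 => w _; rewrite lee_fin.
have c0 : 0 <= c by apply: prodr_ge0.
have W0 w : 0 <= W w by apply: prodr_ge0.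
have mW : measurable_fun setT W by exact: measurable_prod_RV.
(* With an indicator at i0 the induction hypothesis applies: weighting by the other factors
   multiplies the law of X i0 by the constant c. *)
have WD D : measurable D ->
    (\int[P]_w (W w * \1_D (X i0 w))%:E
     = mscale (NngNum c0) (distribution P (X i0)) D)%E.
  move=> mD; pose f' i := if i == i0 then \1_D else f i.
  have f'0 i x : 0 <= f' i x by rewrite /f'; case: ifP.
  have mf' i : measurable_fun setT (f' i).
    by rewrite /f'; case: ifP => // _; exact: measurable_indic.
  transitivity (\int[P]_w (\prod_i f' i (X i w))%:E)%E.
    apply: eq_integral => w _; rewrite (bigD1 i0)//= {1}/f' eqxx mulrC.
    by congr (_ * _)%:E; apply: eq_bigr => i /negbTE; rewrite /f' => ->.
  rewrite (IH (s :\ i0)%SET)//.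
  - rewrite (bigD1 i0)//= {1}/f' eqxx {1}/rexp integral_indic_RV// EFinM fineK; last first.
      by rewrite fin_num_measure// -[X in measurable X]setTI; exact: mX.
    rewrite muleC /mscale /=; congr (_%:E * _)%E.
    by apply: eq_bigr => i /negbTE; rewrite /f' => ->.
  - by move: sm; rewrite (cardsD1 i0) i0s ltnS.
  - move=> i; rewrite /f'; case: eqP => [->|_]; last exact: foo.
    rewrite integral_indic_RV// ltey_eq fin_num_measure//.
    by rewrite -[X in measurable X]setTI; exact: mX.
  - move=> i; rewrite !inE negb_and negbK /f'.
    have [_ _|ne /=] := boolP (i == i0); first by exists D.
    exact: fD.
have := ge0_integral_weight W0 mW (mX i0) WD (f0 i0) (mf i0).
rewrite ge0_integral_mscale//; last 2 first.
- exact/measurable_EFinP.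
- by move=> x _; rewrite lee_fin.
rewrite ge0_integral_distribution//; last 2 first.
- exact/measurable_EFinP.
- by move=> x; rewrite lee_fin.
move=> H.
transitivity (\int[P]_t (W t * f i0 (X i0 t))%:E)%E.
  by apply: eq_integral => w _; rewrite (bigD1 i0)//= mulrC.
rewrite H (bigD1 i0)//= EFinM muleC; congr (_ * _)%E.
rewrite /rexp fineK// fin_numElt foo andbT (lt_le_trans (ltNyr 0))//.
by apply: integral_ge0 => w _; rewrite lee_fin.
Qed.

(** Each f i is the difference of its positive and negative parts. Distributing the product gives
    finitely many products of nonnegative integrable factors, and the sum of their expectations
    factors back. *)
Lemma independent_rexp_prod f :
  (forall i, measurable_fun setT (f i)) ->
  (forall i, has_rexp P (fun w => f i (X i w))) ->
  has_rexp P (fun w => \prod_i f i (X i w)) /\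
  rexp P (fun w => \prod_i f i (X i w)) = \prod_i rexp P (fun w => f i (X i w)).
Proof.
move=> mf If.
pose g (b : bool) i x := if b then Num.max (f i x) 0 else Num.max (- f i x) 0.
pose sgn (b : bool) : R := if b then 1 else -1.
have g0 b i x : 0 <= g b i x by rewrite /g; case: b; rewrite le_max lexx orbT.
have mg b i : measurable_fun setT (g b i).
  rewrite /g; case: b; apply: measurable_maxr => //.
  exact: measurableT_comp.
have fE i x : f i x = \sum_b sgn b * g b i x.
  rewrite big_bool /= /sgn /g mul1r mulN1r.
  case/orP: (le_total 0 (f i x)) => h.
    by rewrite (max_l h) (@max_r _ _ (- f i x)) ?oppr_le0// subr0.
  by rewrite (max_r h) (@max_l _ _ (- f i x)) ?oppr_ge0 // add0r opprK.
have Ig b i : has_rexp P (fun w => g b i (X i w)).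
  have := If i; apply: le_integrable => //.
    by apply/measurable_EFinP; apply: measurableT_comp.
  move=> w _; rewrite !abse_EFin lee_fin ger0_norm// /g; case: b.
    by rewrite ge_max ler_norm normr_ge0.
  by rewrite ge_max normr_ge0 andbT -normrN ler_norm.
have prodE w : \prod_i f i (X i w)
    = \sum_(b : {ffun I -> bool}) (\prod_i sgn (b i)) * \prod_i g (b i) i (X i w).
  under eq_bigr do rewrite fE; rewrite bigA_distr_bigA /=.
  by apply: eq_bigr => b _; rewrite big_split.
have goo b i : (\int[P]_w (g b i (X i w))%:E < +oo)%E by rewrite rexpE// ltry.
have key (b : {ffun I -> bool}) :
    (\int[P]_w (\prod_i g (b i) i (X i w))%:E
     = (\prod_i rexp P (fun w => g (b i) i (X i w)))%:E)%E.
  apply: (@independent_integral_prod_ge0 [set: I]%SET (fun i => g (b i) i)) => //.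
  by move=> i; rewrite inE.
have Ik (b : {ffun I -> bool}) : has_rexp P (fun w => \prod_i g (b i) i (X i w)).
  apply: has_rexp_ge0 => [|w|]; [|exact: prodr_ge0|].
    exact: (@measurable_prod_RV (fun i => g (b i) i) predT).
  by rewrite key ltry.
have -> : (fun w => \prod_i f i (X i w)) = (fun w =>
    \sum_(b : {ffun I -> bool}) (\prod_i sgn (b i)) * \prod_i g (b i) i (X i w)).
  by apply/funext.
split; first by apply: has_rexp_sum => b; exact: has_rexpZ.
rewrite rexp_sum => [|b]; last exact: has_rexpZ.
transitivity (\sum_(b : {ffun I -> bool})
    \prod_i (sgn (b i) * rexp P (fun w => g (b i) i (X i w)))).
  apply: eq_bigr => b _; rewrite (rexpZ (\prod_i sgn (b i)) (Ik b)) big_split /=.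
  by rewrite {1}/rexp key.
rewrite -(bigA_distr_bigA (fun i b => sgn b * rexp P (fun w => g b i (X i w)))) /=.
apply: eq_bigr => i _; under [in RHS]eq_fun do rewrite fE.
rewrite rexp_sum => [|b]; last exact: has_rexpZ.
by apply: eq_bigr => b _; rewrite (rexpZ (sgn b) (Ig b i)).
Qed.

End Independence.

Section GaussianExpectation.
Context {d : measure_display} {Om : measurableType d} {R : realType}.
Variables (P : probability Om R) (X : {RV P >-> R}).
Hypothesis X_normal : forall D : set R, measurable D ->
  distribution P X D = normal_prob 0 1 D.
Let mu := @lebesgue_measure R.

Lemma ge0_integral_normal_RV (f : R -> R) :
  (forall x, 0 <= f x) -> measurable_fun setT f ->
  (\int[P]_w (f (X w))%:E = \int[mu]_x (f x * normal_pdf 0 1 x)%:E)%E.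
Proof.
move=> f0 mf; transitivity (\int[distribution P X]_x (f x)%:E)%E.
  by rewrite ge0_integral_distribution//; exact/measurable_EFinP.
under [RHS]eq_integral do rewrite mulrC.
apply/esym.
apply: (@ge0_integral_weight _ _ _ _ _ mu (distribution P X) (normal_pdf 0 1) id) => //.
- by move=> x; exact: normal_pdf_ge0.
- exact: measurable_normal_pdf.
move=> D mD; rewrite [RHS]X_normal// /normal_prob [RHS]integral_mkcond.
by apply: eq_integral => x _; rewrite epatch_indic /= EFinM.
Qed.

Lemma gaussian_rexp k : has_rexp P (fun w => X w ^+ k) /\
  rexp P (fun w => X w ^+ k) = gaussian_moment R k.
Proof.
have mk : measurable_fun setT (fun x : R => x ^+ k) by exact: exprn_measurable.
split.
  apply/integrableP; split.
    apply/measurable_EFinP; exact: (measurableT_comp mk (measurable_funPT X)).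
  rewrite (_ : (\int[P]_w _)%E = \int[P]_w (`|X w ^+ k|)%:E)%E//.
  rewrite (@ge0_integral_normal_RV (fun x => `|x ^+ k|))//; last by apply: (measurableT_comp _ mk).
  have /integrableP[_] := integrable_monomial_normal R k.
  congr (_ < _)%E; apply: eq_integral => x _.
  by rewrite /= normrM (ger0_norm (normal_pdf_ge0 _ _ _)).
rewrite /rexp /gaussian_moment integralE [in RHS]integralE; congr fine.
have pmax (y : R) x : Num.max (y * normal_pdf 0 1 x) 0 = Num.max y 0 * normal_pdf 0 1 x.
  by rewrite maxr_pMl ?mul0r// normal_pdf_ge0.
congr (_ - _)%E.
  transitivity (\int[P]_w (Num.max (X w ^+ k) 0)%:E)%E.
    by apply: eq_integral => w _; rewrite funeposE -EFin_max.
  rewrite (@ge0_integral_normal_RV (fun x => Num.max (x ^+ k) 0)).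
  - by apply: eq_integral => x _; rewrite funeposE -EFin_max pmax.
  - by move=> x; rewrite le_max lexx orbT.
  - by apply: measurable_maxr.
transitivity (\int[P]_w (Num.max (- X w ^+ k) 0)%:E)%E.
  by apply: eq_integral => w _; rewrite funenegE -EFin_max.
rewrite (@ge0_integral_normal_RV (fun x => Num.max (- x ^+ k) 0)).
- by apply: eq_integral => x _; rewrite funenegE -EFin_max -mulNr pmax.
- by move=> x; rewrite le_max lexx orbT.
- by apply: measurable_maxr => //; apply: measurableT_comp.
Qed.

End GaussianExpectation.

(** * Wick's formula *)

Section PairingCount.
Variables (n N : nat) (J : signed n -> 'I_N).
Implicit Types (S : {set 'I_n}) (rho : {perm signed n}) (x y : 'I_n).

(** Outside [S] the permutation is the identity and no condition bears on [J], so [S] can shrink by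
    one pair at a time, as in the Gaussian recursion. *)
Definition partial_pairing_at S rho (r : signed n) :=
  [&& rho (rho r) == r, rho (sdelta n r) == sdelta n (rho r)
    & if r.1 \in S then ((rho r).1 != r.1) && (J (sdelta n (rho r)) == J r)
      else rho r == r].

Definition partial_pairings S : {set {perm signed n}} :=
  [set rho : {perm signed n} | [forall r, partial_pairing_at S rho r]]%SET.

(** [eta] is the sign of the partner of (x, false). For x_ij and x_kl the values [false] and [true]
    correspond to the covariance terms d_il d_jk and d_ik d_jl. *)
Definition index_match x y (eta : bool) :=
  (J (y, ~~ eta) == J (x, false)) && (J (y, eta) == J (x, true)).

Section Swap.
Variables (x y : 'I_n) (eta : bool).
Hypothesis xy : x != y.

Definition pair_swap_fun (r : signed n) : signed n :=
  if r.1 == x then (y, r.2 (+) eta)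
  else if r.1 == y then (x, r.2 (+) eta) else r.

Lemma pair_swap_funK : involutive pair_swap_fun.
Proof.
move=> [k e]; rewrite /pair_swap_fun /=; have [->|kx] /= := eqVneq k x.
  by rewrite eq_sym (negbTE xy) eqxx -addbA addbb addbF.
have [->|ky] /= := eqVneq k y; first by rewrite eqxx -addbA addbb addbF.
by rewrite (negbTE kx) (negbTE ky).
Qed.

Definition pair_swap : {perm signed n} := perm (inv_inj pair_swap_funK).

(** Multiplication by the swap attaches the pair of [x] and [y], with relative sign [eta], to a
    permutation fixing both. The other pairs are untouched, so [index_match] is the sole new
    condition on [J]. *)
Lemma pair_swap_partial S rho : x \in S -> y \in S ->
  (pair_swap * rho \in partial_pairings S)%g &&
    ((pair_swap * rho)%g (x, false) == (y, eta))
  = index_match x y eta && (rho \in partial_pairings (S :\ x :\ y)%SET).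
Proof.
move=> xS yS; pose Q (r : signed n) := (r.1 == x) || (r.1 == y).
set t := pair_swap; set s := (t * rho)%g.
have tE r : t r = pair_swap_fun r by rewrite permE.
have tK : involutive t by move=> r; rewrite !tE pair_swap_funK.
have tx e : t (x, e) = (y, e (+) eta) by rewrite tE /pair_swap_fun /= eqxx.
have ty e : t (y, e) = (x, e (+) eta).
  by rewrite tE /pair_swap_fun /= eq_sym (negbTE xy) eqxx.
have tN r : ~~ Q r -> t r = r.
  by rewrite negb_or tE /pair_swap_fun => /andP[/negbTE -> /negbTE ->].
have tQ r : Q r -> Q (t r).
  by case: r => k e /orP[]/eqP /= ->; rewrite ?tx ?ty /Q /= eqxx ?orbT.
have td r : t (sdelta n r) = sdelta n (t r).
  by rewrite !tE !sdeltaE /pair_swap_fun /=; do 2?case: ifP => _ //=; rewrite addNb.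
have Qd r : Q (sdelta n r) = Q r by rewrite sdeltaE.
have S'E r : (r.1 \in S :\ x :\ y)%SET = ~~ Q r && (r.1 \in S).
  by rewrite !inE negb_or andbA [_ && (r.1 != x)]andbC.
have link : (forall r, Q r -> rho r = r) ->
    (forall r, partial_pairing_at S s r) <->
    index_match x y eta /\ forall r, partial_pairing_at (S :\ x :\ y)%SET rho r.
  move=> fix_.
  have sQ r : Q r -> s r = t r by move=> Qr; rewrite permM fix_ ?tQ.
  have sN r : ~~ Q r -> s r = rho r by move=> Qr; rewrite permM tN.
  have rN r : ~~ Q r -> ~~ Q (rho r).
    by move=> Qr; apply: contra Qr => h; rewrite -(perm_inj (fix_ _ h)).
  split=> [h|[/andP[/eqP m1 /eqP m2] h] r].
    split; last first.
      move=> r; have := h r; rewrite /partial_pairing_at S'E.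
      have [Qr|Qr] /= := boolP (Q r).
        by rewrite !fix_ ?Qd// !eqxx.
      by rewrite !sN ?Qd ?rN.
    have /and3P[_ _] := h (x, false); rewrite /= xS sQ ?/Q ?eqxx// tx sdeltaE /=.
    case/andP => _; rewrite /index_match => ->.
    have /and3P[_ _] := h (x, true); rewrite /= xS sQ ?/Q ?eqxx// tx sdeltaE /=.
    by case/andP => _; rewrite negbK.
  have := h r; rewrite /partial_pairing_at S'E.
  have [Qr|Qr] /= := boolP (Q r); last by rewrite !sN ?Qd ?rN.
  move=> _; rewrite !sQ ?tQ ?Qd// tK td !eqxx /=.
  case: r Qr => k e /orP[]/eqP /= ->; rewrite ?xS ?yS ?tx ?ty /= sdeltaE /=.
    rewrite eq_sym xy /=; case: e; first by rewrite /= negbK m2.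
    by rewrite /= m1.
  rewrite xy /=; case: e; move: m1 m2; case: (eta) => //= m1 m2.
  - by rewrite m2.
  - by rewrite m1.
  - by rewrite m1.
  - by rewrite m2.
rewrite !inE; apply/andP/andP => [[/forallP h /eqP sx]|[m /forallP h]].
  have fx : forall r, Q r -> rho r = r.
    have sK r : s (s r) = r by have /and3P[/eqP] := h r.
    have sd r : s (sdelta n r) = sdelta n (s r) by have /and3P[_ /eqP] := h r.
    have sxe e : s (x, e) = (y, e (+) eta).
      case: e; last by [].
      have -> : (x, true) = sdelta n (x, false) by rewrite sdeltaE.
      by rewrite sd sx sdeltaE.
    have sye e : s (y, e) = (x, e (+) eta).
      by rewrite -[RHS]sK sxe -addbA addbb addbF.
    move=> [k e] /orP[]/eqP /= ->.
      by have := sye (e (+) eta); rewrite permM ty -addbA addbb addbF.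
    by have := sxe (e (+) eta); rewrite permM tx -addbA addbb addbF.
  by have [m h'] := (link fx).1 h; split=> //; exact/forallP.
have fx : forall r, Q r -> rho r = r.
  by move=> r Qr; have /and3P[_ _] := h r; rewrite S'E Qr /= => /eqP.
split; first by apply/forallP; apply/(link fx); split.
by rewrite permM tx /= fx // /Q /= eqxx orbT.
Qed.

End Swap.

Lemma partial_pairings0 : #|partial_pairings finset.set0| = 1%N.
Proof.
apply/eqP/cards1P; exists 1%g; apply/setP => rho; rewrite !inE.
apply/forallP/eqP => [h|-> r]; last first.
  by rewrite /partial_pairing_at !perm1 inE !eqxx.
by apply/permP => r; rewrite perm1; have /and3P[_ _] := h r; rewrite inE => /eqP.
Qed.

Lemma partial_pairings_rec S x : x \in S ->
  #|partial_pairings S| = (\sum_(y in S :\ x) \sum_(eta : bool)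
    index_match x y eta * #|partial_pairings (S :\ x :\ y)%SET|)%N.
Proof.
move=> xS; rewrite -sum1_card.
rewrite (partition_big (fun rho : {perm signed n} => rho (x, false)) predT)//=.
rewrite -(pair_bigA _ (fun y eta => \sum_(rho in partial_pairings S
  | rho (x, false) == (y, eta)) 1)%N) /=.
rewrite (bigID (fun y => y \in S :\ x)%SET) /= [X in (_ + X)%N]big1 ?addn0; last first.
  move=> y yS; rewrite big1// => eta _; rewrite big_pred0// => rho.
  apply/andP => -[]; rewrite inE => /forallP h /eqP rx.
  have /and3P[/eqP rr _] := h (x, false); rewrite /= xS rx => /andP[/= yx _].
  move: rr; rewrite rx; have /and3P[_ _] := h (y, eta).
  move: yS; rewrite !inE yx /= => /negbTE -> /eqP -> [yx' _].
  by rewrite yx' eqxx in yx.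
apply: eq_bigr => y; rewrite !inE => /andP[yx yS]; apply: eq_bigr => eta _.
have xy : x != y by rewrite eq_sym.
rewrite (reindex_inj (mulgI (pair_swap eta xy))) /=.
rewrite (eq_bigl _ _ (fun rho => pair_swap_partial eta xy rho xS yS)).
by case: index_match => /=; rewrite ?mul1n ?mul0n sum1_card// card0.
Qed.

Lemma partial_pairingsT :
  partial_pairings finset.setT =
  [set rho in signed_pairing n | [forall r, J (sdelta n (rho r)) == J r]]%SET.
Proof.
apply/setP => rho; rewrite !inE; apply/forallP/andP => [h|[/forallP h1 /forallP h2] r].
  by split; apply/forallP => r; have := h r;
    rewrite /partial_pairing_at inE => /and3P[h1 h2 /andP[h3 h4]] //; apply/and3P.
by have := h1 r; rewrite /partial_pairing_at inE h2 andbT => /and3P[-> -> ->].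
Qed.

End PairingCount.

(** * The same recursion for Gaussian products *)

Section GaussianWick.
Context {d : measure_display} {Om : measurableType d} {R : realType}.
Variables (P : probability Om R) (I : finType) (g : I -> {RV P >-> R}).
Hypothesis g_iid : iid_std_normal g.

Section Colouring.
Variables (T : finType) (c : T -> I).
Implicit Types S : {set T}.

Definition gaussian_product S : R := rexp P (fun w => \prod_(k in S) g (c k) w).

Let colour_class S i := [set k in S | c k == i]%SET.

Lemma gaussian_productE S :
  has_rexp P (fun w => \prod_(k in S) g (c k) w) /\
  gaussian_product S = \prod_i gaussian_moment R #|colour_class S i|.
Proof.
case: g_iid => ind nrm.
have e : (fun w => \prod_(k in S) g (c k) w)
    = (fun w => \prod_i g i w ^+ #|colour_class S i|).
  apply/funext => w; rewrite (partition_big c predT)//=.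
  apply: eq_bigr => i _; rewrite -prodr_const; apply: eq_big => [k|k /andP[_ /eqP ->//]].
  by rewrite inE.
rewrite /gaussian_product e.
have [|i|h1 h2] := independent_rexp_prod (f := fun i x => x ^+ #|colour_class S i|) ind.
- by move=> i; exact: exprn_measurable.
- by have [] := gaussian_rexp (nrm i) #|colour_class S i|.
split=> //; rewrite h2; apply: eq_bigr => i _.
by have [] := gaussian_rexp (nrm i) #|colour_class S i|.
Qed.

Lemma gaussian_product0 : gaussian_product finset.set0 = 1.
Proof.
rewrite (gaussian_productE _).2 big1// => i _; rewrite -[RHS](gaussian_moment0 R).
by congr gaussian_moment; apply: eq_card0 => k; rewrite !inE.
Qed.

(** Let q be the number of other factors equal to g (c x). In E(g^(q+1)) = q E(g^(q-1)) the
    coefficient q counts the possible partners [y], and all of them leave the same product. *)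
Lemma gaussian_product_rec S x : x \in S ->
  gaussian_product S
  = \sum_(y in (S :\ x)%SET) (c x == c y)%:R * gaussian_product (S :\ x :\ y)%SET.
Proof.
move=> xS; rewrite (gaussian_productE _).2 (bigD1 (c x))//=.
set q := #|colour_class (S :\ x)%SET (c x)|.
pose rest := \prod_(i | i != c x) gaussian_moment R #|colour_class S i|.
have cardx : #|colour_class S (c x)| = q.+1.
  rewrite (cardsD1 x) !inE xS eqxx add1n; congr _.+1; apply: eq_card => k.
  by rewrite !inE andbA.
have term y : y \in (S :\ x)%SET -> c x == c y ->
    gaussian_product (S :\ x :\ y)%SET = gaussian_moment R q.-1 * rest.
  move=> yS /eqP cxy; rewrite (gaussian_productE _).2 (bigD1 (c x))//=; congr (_ * _).
    suff -> : q = #|colour_class (S :\ x :\ y)%SET (c x)|.+1 by [].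
    have yq : y \in colour_class (S :\ x)%SET (c x) by rewrite inE yS cxy eqxx.
    rewrite /q (cardsD1 y) yq add1n; congr _.+1; apply: eq_card => k.
    by rewrite !inE !andbA.
  apply: eq_bigr => i ine; congr gaussian_moment; apply: eq_card => k; rewrite !inE.
  have [cki|] := eqVneq (c k) i; rewrite ?andbF// !andbT.
  have kx : k != x by apply: contraNneq ine => <-; rewrite cki.
  have ky : k != y by apply: contraNneq ine => ky; rewrite cxy -ky cki.
  by rewrite kx ky.
rewrite cardx gaussian_momentS -/rest -mulrA.
transitivity (\sum_(y in colour_class (S :\ x)%SET (c x)) gaussian_moment R q.-1 * rest).
  by rewrite sumr_const mulr_natl.
rewrite [RHS](bigID (fun y => c x == c y)) /= [X in _ + X]big1 ?addr0; last first.
  by move=> y /andP[_ /negbTE ->]; rewrite mul0r.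
apply: eq_big => [y|y]; first by rewrite inE eq_sym.
by rewrite inE eq_sym => /andP[yS cxy]; rewrite cxy mul1r term.
Qed.

End Colouring.
End GaussianWick.

Section GOEWick.
Context {d : measure_display} {Om : measurableType d} {R : realType}.
Variables (P : probability Om R) (n N : nat) (g : 'I_N * 'I_N -> {RV P >-> R}).
Hypothesis g_iid : iid_std_normal g.

Section Indices.
Variable J : signed n -> 'I_N.
Implicit Types (S : {set 'I_n}) (e : {ffun 'I_n -> bool}).

(* e chooses, in each factor g_ij + g_ji, one of the two summands. *)
Let colour e k := (J (k, e k), J (k, ~~ e k)).
Let G S e := gaussian_product g (colour e) S.

(** Two factors have the same colour when [index_match] holds for the sign telling whether [e]
    orients [x] and [y] alike. Flipping [e] at [x] exchanges the two signs and leaves the remaining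
    factors unchanged, so each sign gets half of the orientations. *)
Lemma sum_orientations_rec S x : x \in S ->
  \sum_e G S e = 2^-1 * \sum_(y in (S :\ x)%SET) \sum_(eta : bool)
    (index_match J x y eta)%:R * \sum_e G (S :\ x :\ y)%SET e.
Proof.
move=> xS; under eq_bigr do rewrite /G (gaussian_product_rec g_iid _ xS).
rewrite exchange_big mulr_sumr /=; apply: eq_bigr => y; rewrite !inE => /andP[yx yS].
set S' := (S :\ x :\ y)%SET.
pose m eta : R := (index_match J x y eta)%:R; pose h e := ~~ (e x (+) e y).
pose flip e : {ffun 'I_n -> bool} := [ffun k => e k (+) (k == x)].
have flipK : involutive flip.
  by move=> e; apply/ffunP => k; rewrite !ffunE -addbA addbb addbF.
have mE e : (colour e x == colour e y)%:R = m (h e).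
  rewrite /m /index_match /h /colour xpair_eqE; congr (_%:R).
  by case: (e x); case: (e y); rewrite /= ?(eq_sym (J (y, _))) // andbC.
have Gflip e : G S' (flip e) = G S' e.
  rewrite /G /gaussian_product; congr (rexp P _); apply/funext => w.
  apply: eq_bigr => k; rewrite !inE => /and3P[ky kx _].
  by rewrite /colour !ffunE (negbTE kx) addbF.
have hflip e : h (flip e) = ~~ h e.
  by rewrite /h !ffunE eqxx (negbTE yx) addbF addbT addNb.
under eq_bigr do rewrite mE.
have flipS : \sum_e m (h e) * G S' e = \sum_e m (~~ h e) * G S' e.
  rewrite (reindex_inj (inv_inj flipK)) /=; apply: eq_bigr => e _.
  by rewrite hflip Gflip.
have : 2 * \sum_e m (h e) * G S' e = \sum_(eta : bool) m eta * \sum_e G S' e.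
  rewrite mulr_natl mulr2n {2}flipS -big_split -mulr_suml mulr_sumr /=.
  apply: eq_bigr => e _; rewrite -mulrDl big_bool.
  by case: (h e); rewrite //= addrC.
by move=> <-; rewrite mulrA mulVf// mul1r.
Qed.

(** The empty set leaves all 2^n orientations, and each pair contributes 1/2, that is 1/sqrt 2 for
    each of its two elements. *)
Lemma sum_orientations S : \sum_e G S e
  = 2 ^+ n * (Num.sqrt 2)^-1 ^+ #|S| * #|partial_pairings J S|%:R.
Proof.
have [k] := ubnP #|S|; elim: k S => // k IH S Sk.
have [->|[x xS]] := set_0Vmem S.
  rewrite partial_pairings0 cards0 expr0 !mulr1.
  under eq_bigr do rewrite /G (gaussian_product0 g_iid).
  by rewrite sumr_const card_ffun card_ord card_bool -natrX.
rewrite (sum_orientations_rec xS) (partial_pairings_rec J xS).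
rewrite natr_sum !mulr_sumr; apply: eq_bigr => y yS.
rewrite natr_sum !mulr_sumr; apply: eq_bigr => eta _.
have cardS : #|S| = #|(S :\ x :\ y)%SET|.+2.
  by rewrite (cardsD1 x) xS (cardsD1 y) yS.
rewrite IH; last by move: Sk; rewrite cardS ltnS => /ltnW.
rewrite cardS !exprS natrM; move: (_ ^+ #|_|) => z.
have -> : (2^-1 : R) = (Num.sqrt 2)^-1 * (Num.sqrt 2)^-1.
  by rewrite -invfM -expr2 sqr_sqrtr.
by ring.
Qed.

Lemma goe_wick :
  let Y w := \prod_k ((Num.sqrt (2 * N%:R))^-1 *
               (g (J (k, false), J (k, true)) w + g (J (k, true), J (k, false)) w)) in
  has_rexp P Y /\
  rexp P Y = (Num.sqrt N%:R)^-1 ^+ n *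
    #|[set rho in signed_pairing n | [forall r, J (sdelta n (rho r)) == J r]]%SET|%:R.
Proof.
move=> Y; pose s : R := (Num.sqrt (2 * N%:R))^-1.
have YE : Y = fun w => s ^+ n * \sum_e \prod_(k in [set: 'I_n]%SET) g (colour e k) w.
  apply/funext => w; rewrite /Y big_split /= prodr_const card_ord; congr (_ * _).
  transitivity (\prod_k \sum_(b : bool) g (J (k, b), J (k, ~~ b)) w).
    by apply: eq_bigr => k _; rewrite big_bool addrC.
  rewrite bigA_distr_bigA; apply: eq_bigr => e _.
  by apply: eq_bigl => k; rewrite inE.
have iG e : has_rexp P (fun w => \prod_(k in [set: 'I_n]%SET) g (colour e k) w).
  exact: (gaussian_productE g_iid _ _).1.
rewrite YE; split; first by apply: has_rexpZ; exact: has_rexp_sum.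
rewrite rexpZ; last exact: has_rexp_sum.
rewrite rexp_sum// -/(G [set: 'I_n]%SET) sum_orientations cardsT card_ord.
rewrite partial_pairingsT !mulrA; congr (_ * _).
(* For each factor, 1/sqrt(2N) times 2 times 1/sqrt 2 equals 1/sqrt N. *)
rewrite -!exprMn; congr (_ ^+ n); rewrite /s sqrtrM// invfM.
have e2 : (2 : R) * (Num.sqrt 2)^-1 * (Num.sqrt 2)^-1 = 1.
  by rewrite -mulrA -invfM -expr2 sqr_sqrtr// divff.
move: e2; move: (_^-1) (_^-1) => a b e2; have -> : b * a * 2 * b = 2 * b * b * a by ring.
by rewrite e2 mul1r.
Qed.

End Indices.
End GOEWick.

(** * Expansion and expectation of the trace *)

Section TraceExpansion.
Variables (C : comNzRingType) (n N : nat).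

Lemma cycle_seq_gamma : (0 < n)%N -> porbits (gamma n) = [set [set: 'I_n]]%SET
  /\ cycle_seq (gamma n) [set: 'I_n]%SET = enum 'I_n.
Proof.
move=> n0; have orb k : porbit (gamma n) k = [set: 'I_n]%SET.
  by apply/setP => l; rewrite inE porbit_gamma.
split.
  apply/setP => c; rewrite inE; apply/imsetP/eqP => [[k _ ->]|->]; first exact: orb.
  by exists (Ordinal n0); rewrite ?orb.
have eT : enum [set: 'I_n]%SET = enum 'I_n by apply: eq_enum => k; rewrite !inE.
have e0 : enum 'I_n = Ordinal n0 :: behead (enum 'I_n).
  have := nth_ord_enum (Ordinal n0) (Ordinal n0); have := size_enum_ord n.
  by case: (enum 'I_n) => [|k s] /= sz; [exfalso; move: (n0); rewrite -sz|move=> ->].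
rewrite /cycle_seq eT [in LHS]e0 cardsT card_ord.
apply: (@eq_from_nth _ (Ordinal n0)); first by rewrite size_traject size_enum_ord.
move=> i; rewrite size_traject => iltn; rewrite nth_traject//.
apply: ord_inj; rewrite nth_enum_ord//.
elim: i iltn => //= i IH ilt; rewrite gamma_val IH// ltnW//.
Qed.

(** [sum_cycles] read backwards for the single cycle [gamma]. The row and column indices of the k-th
    X become the values of [J] at k and -k. *)
Lemma mxtrace_expansion (X : 'M[C]_N) (A : 'I_n -> 'M[C]_N) :
  (0 < n)%N -> (0 < N)%N ->
  \tr (\prod_(k < n) (X *m A k)) = \sum_(J : {ffun signed n -> 'I_N})
    (\prod_k X (J (k, false)) (J (k, true))) *
    \prod_k A k (J (k, true)) (J (gamma n k, false)).
Proof.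
move=> n0 N0; have [porb cyc] := cycle_seq_gamma n0.
transitivity (\sum_(u : {ffun 'I_n -> 'I_N})
    \prod_k (X *m A k) (u k) (u (gamma n k))).
  by rewrite sum_cycles// porb big_set1 cyc enumT [index_enum _]unlock.
transitivity (\sum_(u : {ffun 'I_n -> 'I_N}) \sum_(v : {ffun 'I_n -> 'I_N})
    \prod_k (X (u k) (v k) * A k (v k) (u (gamma n k)))).
  by apply: eq_bigr => u _; under eq_bigr do rewrite mxE; rewrite bigA_distr_bigA.
rewrite pair_bigA /=.
rewrite (reindex (fun J : {ffun signed n -> 'I_N} =>
  ([ffun k => J (k, false)], [ffun k => J (k, true)]))) /=; last first.
  exists (fun uv : {ffun 'I_n -> 'I_N} * {ffun 'I_n -> 'I_N} =>
    [ffun r : signed n => if r.2 then uv.2 r.1 else uv.1 r.1]) => [J _|[u v] _].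
    by apply/ffunP => -[k [|]]; rewrite !ffunE.
  by congr pair; apply/ffunP => k; rewrite !ffunE.
by apply: eq_bigr => J _; rewrite -big_split; apply: eq_bigr => k _; rewrite !ffunE.
Qed.

End TraceExpansion.

Section GOETrace.
Context {d : measure_display} {Om : measurableType d} {R : realType}.
Variables (P : probability Om R).

Lemma cexpectation_sum (I : finType) (Y : I -> Om -> R) (a : I -> R[i]) :
  (forall i, has_rexp P (Y i)) ->
  cexpectation P (fun w => \sum_i (Y i w)%:C * a i) = \sum_i (rexp P (Y i))%:C * a i.
Proof.
move=> iY; have lin (b : I -> R) :
    fine ('E_P[fun w => (\sum_i Y i w * b i)%R])%E = \sum_i rexp P (Y i) * b i.
  rewrite unlock -/(rexp P (fun w => \sum_i Y i w * b i)).
  have -> : (fun w => \sum_i Y i w * b i) = fun w => \sum_i b i * Y i w.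
    by apply/funext => w; apply: eq_bigr => i _; rewrite mulrC.
  rewrite rexp_sum => [|i]; last exact: has_rexpZ.
  by apply: eq_bigr => i _; rewrite (rexpZ _ (iY i)) mulrC.
have ReM (y : R) (z : R[i]) : complex.Re (y%:C * z) = y * complex.Re z.
  by case: z => p q; rewrite /= mul0r subr0.
have ImM (y : R) (z : R[i]) : complex.Im (y%:C * z) = y * complex.Im z.
  by case: z => p q; rewrite /= mul0r addr0.
have sumRe (F : I -> R[i]) : complex.Re (\sum_i F i) = \sum_i complex.Re (F i).
  exact: (raddf_sum (@complex.Re R)).
have sumIm (F : I -> R[i]) : complex.Im (\sum_i F i) = \sum_i complex.Im (F i).
  exact: (raddf_sum (@complex.Im R)).
apply/eqP; rewrite eq_complex /cexpectation /= sumRe sumIm; apply/andP; split; apply/eqP.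
- under eq_fun do rewrite sumRe; under eq_fun do under eq_bigr do rewrite ReM.
  by rewrite lin; apply: eq_bigr => i _; rewrite ReM.
- under eq_fun do rewrite sumIm; under eq_fun do under eq_bigr do rewrite ImM.
  by rewrite lin; apply: eq_bigr => i _; rewrite ImM.
Qed.

(** Wick's formula counts the pairings compatible with given indices; exchanging the two sums fixes
    the pairing instead. The prefactor N cancels the 1/N of [ntr]. *)
Lemma goe_trace_expectation (n N : nat) (g : 'I_N * 'I_N -> {RV P >-> R})
    (A : 'I_n -> 'M[R[i]]_N) :
  iid_std_normal g -> (0 < n)%N -> (0 < N)%N ->
  N%:R * cexpectation P (fun w => ntr (\prod_(k < n) (goe g w *m A k)))
  = ((Num.sqrt N%:R)^-1 ^+ n)%:C * \sum_(rho in signed_pairing n)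
      \sum_(J : {ffun signed n -> 'I_N} | [forall r, J (sdelta n (rho r)) == J r])
        \prod_k A k (J (k, true)) (J (gamma n k, false)).
Proof.
move=> g_iid n0 N0; set s := (Num.sqrt N%:R)^-1 ^+ n.
pose Y (J : {ffun signed n -> 'I_N}) w := \prod_k ((Num.sqrt (2 * N%:R))^-1 *
  (g (J (k, false), J (k, true)) w + g (J (k, true), J (k, false)) w)).
pose W (J : {ffun signed n -> 'I_N}) := \prod_k A k (J (k, true)) (J (gamma n k, false)).
have -> : (fun w => ntr (\prod_(k < n) (goe g w *m A k)))
    = fun w => \sum_J (Y J w)%:C * (N%:R^-1 * W J).
  apply/funext => w; rewrite /ntr mxtrace_expansion// mulr_sumr.
  apply: eq_bigr => J _; rewrite mulrCA; congr (_ * _).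
  rewrite /Y rmorph_prod; apply: eq_bigr => k _.
  by rewrite /goe !mxE.
rewrite cexpectation_sum => [|J]; last exact: (goe_wick g_iid J).1.
transitivity (\sum_J (rexp P (Y J))%:C * W J).
  rewrite mulr_sumr; apply: eq_bigr => J _; rewrite mulrCA; congr (_ * _).
  by rewrite mulrA divff ?mul1r// pnatr_eq0 -lt0n.
under eq_bigr do rewrite (goe_wick g_iid _).2 -/s.
rewrite (exchange_big_dep predT)//= mulr_sumr; apply: eq_bigr => J _.
rewrite rmorphM -mulrA; congr (_ * _); rewrite rmorph_nat -sum1_card natr_sum mulr_suml.
by apply: eq_big => [rho|rho _]; rewrite ?inE ?mul1r.
Qed.

End GOETrace.

(** * Non-crossing partitions into pairs *)

Section NoncrossingPartitions.
Variable n : nat.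
Implicit Types (p : {perm 'I_n}) (pi : {set {set 'I_n}}).

Lemma pblock_porbits p k : finset.pblock (porbits p) k = porbit p k.
Proof.
by apply: finset.def_pblock; rewrite ?trivIset_porbits ?imset_f ?porbit_id.
Qed.

Lemma porbits_partition p : finset.partition (porbits p) [set: 'I_n]%SET.
Proof.
rewrite /finset.partition cover_porbits eqxx trivIset_porbits.
by apply/imsetP => -[x _] /setP/(_ x); rewrite inE porbit_id.
Qed.

Lemma next_pair (B : {set 'I_n}) k : #|B| = 2 -> k \in B ->
  [/\ next (enum B) k \in B, next (enum B) k != k,
      next (enum B) (next (enum B) k) = k
    & B = [set k; next (enum B) k]%SET].
Proof.
move=> B2 kB; set l := next _ k.
have lB : l \in B by rewrite -mem_enum mem_next mem_enum.
have lk : l != k /\ next (enum B) l = k.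
  rewrite /l; have := enum_uniq (mem B); have := mem_enum (mem B) k; have := B2.
  rewrite cardE; case: (enum B) => [|x [|y [|]]] //= _; rewrite !inE kB.
  by move=> /orP[]/eqP -> /andP[xy _]; rewrite !eqxx ?(negbTE xy) ?(eq_sym y)
    ?(negbTE xy) ?eqxx ?(negbTE xy) ?(eq_sym y x) ?xy //= ?(eq_sym y x) ?(negbTE xy) ?eqxx.
case: lk => lk ll; split=> //; apply/esym/eqP; rewrite eqEcard cards2 eq_sym lk B2.
by rewrite andbT; apply/fintype.subsetP => z; rewrite !inE => /orP[]/eqP ->.
Qed.

Definition all_pairs pi := [forall V in pi, #|V| == 2]%N.

Lemma cumulant_semicircular (C : comPzRingType) (T : finType) (pi : {set {set T}}) :
  cumulant_part (@semicircular C) pi = ([forall V in pi, #|V| == 2%N])%:R.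
Proof.
case: (boolP [forall V in pi, _]) => [/forall_inP h|].
  by apply: big1 => V /h h2; rewrite /semicircular h2.
rewrite negb_forall_in => /exists_inP[V Vpi h]; rewrite /cumulant_part (bigD1 V)//=.
by rewrite /semicircular (negbTE h) mul0r.
Qed.

Lemma perm_of_partK pi : finset.partition pi [set: 'I_n]%SET -> all_pairs pi ->
  is_pairing (perm_of_part pi) /\ porbits (perm_of_part pi) = pi.
Proof.
move=> part /forall_inP pairs; have qE := perm_of_funE (next_in_block_inj part).
have /and3P[/eqP cov tI n0] := part.
have blk k : k \in finset.pblock pi k by rewrite finset.mem_pblock cov inE.
have bpi k : finset.pblock pi k \in pi by rewrite finset.pblock_mem// cov inE.
have blk2 k : #|finset.pblock pi k| = 2 by exact/eqP/pairs.
have same k : finset.pblock pi (perm_of_part pi k) = finset.pblock pi k.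
  by rewrite qE; apply: finset.same_pblock => //; case: (next_pair (blk2 k) (blk k)).
have pp : is_pairing (perm_of_part pi).
  apply/forallP => k; have [h1 h2 h3 h4] := next_pair (blk2 k) (blk k).
  by rewrite [perm_of_part pi (_ _)]qE /next_in_block same qE h2 h3 eqxx.
have orb k : porbit (perm_of_part pi) k = finset.pblock pi k.
  apply/esym/eqP; rewrite eqEcard card_pairing_porbit// blk2 leqnn andbT.
  have [h1 h2 h3 ->] := next_pair (blk2 k) (blk k).
  apply/fintype.subsetP => z; rewrite !inE => /orP[]/eqP ->; first exact: porbit_id.
  by rewrite -[next _ _]qE -eq_porbit_mem porbit_step.
split=> //; apply/setP => V; apply/imsetP/idP => [[k _ ->]|Vpi]; first by rewrite orb bpi.
have /set0Pn[k kV] : V != finset.set0 by apply/negP => /eqP V0; rewrite -V0 Vpi in n0.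
by exists k => //; rewrite orb (finset.def_pblock tI Vpi kV).
Qed.

Lemma porbits_all_pairs p : is_pairing p -> all_pairs (porbits p).
Proof. by move=> pp; apply/forall_inP => _ /imsetP[k _ ->]; rewrite card_pairing_porbit. Qed.

Lemma mem_pairing_porbit p k l : is_pairing p ->
  (l \in porbit p k) = (l == k) || (l == p k).
Proof.
move=> pp; suff -> : porbit p k = [set k; p k]%SET by rewrite !inE.
apply/esym/eqP; rewrite eqEcard card_pairing_porbit// cards2 eq_sym pairing_neq//.
rewrite andbT; apply/fintype.subsetP => z; rewrite !inE => /orP[]/eqP ->.
  exact: porbit_id.
by rewrite -eq_porbit_mem porbit_step.
Qed.

Lemma porbits_permK p : is_pairing p -> perm_of_part (porbits p) = p.
Proof.
move=> pp; apply/permP => k; rewrite perm_of_funE; last first.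
  exact: next_in_block_inj (porbits_partition p).
rewrite /next_in_block pblock_porbits.
have [h1 h2 _ _] := next_pair (card_pairing_porbit k pp) (porbit_id p k).
by move: h1; rewrite mem_pairing_porbit// (negbTE h2) => /eqP.
Qed.

Lemma noncrossing_porbits p : is_pairing p -> noncrossing (porbits p) = nc_perm p.
Proof.
move=> pp; have eqb (x y : 'I_n) : (x < y)%N ->
    (finset.pblock (porbits p) x == finset.pblock (porbits p) y) = (p x == y).
  move=> xy; rewrite !pblock_porbits eq_sym eq_porbit_mem mem_pairing_porbit//.
  by rewrite -val_eqE /= (gtn_eqF xy) /= eq_sym.
apply/forallP/forallP => h a; apply/forallP => b; apply/forallP => c; apply/forallP => e.
  apply/implyP => /and5P[ab bc ce pa pb].
  have /forallP/(_ b)/forallP/(_ c)/forallP/(_ e)/implyP := h a.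
  have ac := ltn_trans ab bc; have be := ltn_trans bc ce.
  rewrite ab bc ce (eqb _ _ ac) (eqb _ _ be) (eqb _ _ ab) pa pb => /(_ isT)/eqP pab.
  by rewrite pab in pa; rewrite (eqP pa) ltnn in bc.
apply/implyP => /and5P[ab bc ce].
rewrite (eqb _ _ (ltn_trans ab bc)) (eqb _ _ (ltn_trans bc ce)) => pa pb.
have /forallP/(_ b)/forallP/(_ c)/forallP/(_ e)/implyP := h a.
by rewrite ab bc ce pa pb => /(_ isT).
Qed.

(** The semicircular cumulants kill every partition that is not a pairing, and a pairing is its own
    inverse. [F] is arbitrary because the formula serves both for phi and for its derivative. *)
Lemma sum_NC (C : comPzRingType) (F : {set {set 'I_n}} -> C) :
  \sum_(pi in NC n) cumulant_part (@semicircular C) pi * F (kreweras pi)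
  = \sum_(p | is_pairing p && nc_perm p) F (porbits (gamma n * p)%g).
Proof.
rewrite (bigID all_pairs) /= [X in _ + X]big1 ?addr0; last first.
  by move=> pi /andP[_ /negbTE h]; rewrite cumulant_semicircular -/(all_pairs pi) h mul0r.
rewrite (reindex_onto (fun p => porbits p) (@perm_of_part n)) /=; last first.
  by move=> pi /andP[]; rewrite inE => /andP[part _] /(perm_of_partK part)[].
apply: eq_big => [p|p /andP[/andP[_ h] /eqP pK]]; last first.
  rewrite cumulant_semicircular -/(all_pairs _) h mul1r /kreweras pK involutionV//.
  by rewrite -pK; apply: pairingK; have [] := perm_of_partK (porbits_partition p) h.
rewrite inE porbits_partition /=; apply/idP/andP => [/andP[/andP[nc h] /eqP pK]|[pp nc]].
  have pp : is_pairing p.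
    by rewrite -pK; have [] := perm_of_partK (porbits_partition p) h.
  by rewrite -noncrossing_porbits.
by rewrite noncrossing_porbits// nc porbits_all_pairs// porbits_permK// eqxx.
Qed.

End NoncrossingPartitions.

(** * Limits *)

Section ComplexSequences.
Variable R : realType.
Implicit Types (u v : nat -> R[i]).

Lemma cvg_seq_eq_pos v u (l : R[i]) : (forall N, (0 < N)%N -> u N = v N) ->
  (v : nat -> R[i]^o) @ \oo --> (l : R[i]^o) ->
  (u : nat -> R[i]^o) @ \oo --> (l : R[i]^o).
Proof.
move=> uv; apply: cvg_trans; apply: near_eq_cvg.
by exists 1%N => // N /= N0; exact/esym/uv.
Qed.

Lemma cvg_natC_inv :
  ((fun N : nat => N%:R^-1) : nat -> R[i]^o) @ \oo --> (0 : R[i]^o).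
Proof.
apply/cvgr0Pnorm_lt => eps eps0.
have epsE : eps = (complex.Re eps)%:C.
  by apply/esym/RRe_real; exact: gtr0_real.
have e0 : 0 < complex.Re eps by move: eps0; rewrite {1}epsE ltcR.
exists (Num.truncn (complex.Re eps)^-1).+1 => // N /= Nlt.
have hN : (complex.Re eps)^-1 < N%:R.
  by apply: lt_le_trans (truncnS_gt _) _; rewrite ler_nat.
have N0 : 0 < N%:R :> R by apply: lt_trans hN; rewrite invr_gt0.
rewrite normfV normr_nat epsE -(rmorph_nat (real_complex R)) -fmorphV ltcR.
by rewrite invf_plt// posrE.
Qed.

Lemma cvg_seq_prod (I : eqType) (s : seq I) (Q : pred I) (f : I -> nat -> R[i])
    (l : I -> R[i]) :
  (forall i, i \in s -> Q i -> (f i : nat -> R[i]^o) @ \oo --> (l i : R[i]^o)) ->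
  ((fun N => \prod_(i <- s | Q i) f i N) : nat -> R[i]^o) @ \oo
    --> (\prod_(i <- s | Q i) l i : R[i]^o).
Proof.
elim: s => [|i s IH] h.
  rewrite big_nil; under eq_fun do rewrite big_nil; exact: cvg_cst.
have {}IH := IH (fun j js => h j (@mem_behead _ (i :: s) j js)).
rewrite big_cons; under eq_fun do rewrite big_cons.
case: ifP => Qi; last exact: IH.
by apply: cvgM; [apply: h => //; exact: mem_head|exact: IH].
Qed.

Lemma cvg_seq_sum (I : Type) (s : seq I) (Q : pred I) (f : I -> nat -> R[i]) (l : I -> R[i]) :
  (forall i, Q i -> (f i : nat -> R[i]^o) @ \oo --> (l i : R[i]^o)) ->
  ((fun N => \sum_(i <- s | Q i) f i N) : nat -> R[i]^o) @ \oo
    --> (\sum_(i <- s | Q i) l i : R[i]^o).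
Proof.
move=> h; elim: s => [|i s IH].
  rewrite big_nil; under eq_fun do rewrite big_nil; exact: cvg_cst.
rewrite big_cons; under eq_fun do rewrite big_cons.
case: ifP => Qi; last exact: IH.
apply: cvgD; [exact: h|exact: IH].
Qed.

(** The Leibniz rule, by iterating N (f g - l m) = N (f - l) g + l N (g - m). *)
Lemma cvg_seq_prodB (I : eqType) (s : seq I) (f : I -> nat -> R[i]) (l l' : I -> R[i]) :
  uniq s ->
  (forall i, i \in s -> (f i : nat -> R[i]^o) @ \oo --> (l i : R[i]^o)) ->
  (forall i, i \in s -> ((fun N => N%:R * (f i N - l i)) : nat -> R[i]^o) @ \oo
    --> (l' i : R[i]^o)) ->
  ((fun N => N%:R * (\prod_(i <- s) f i N - \prod_(i <- s) l i)) : nat -> R[i]^o) @ \oo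
    --> (\sum_(i <- s) l' i * \prod_(j <- s | j != i) l j : R[i]^o).
Proof.
elim: s => [|i s IH] /=.
  move=> _ _ _; rewrite [X in _ --> X]big_nil.
  apply: (@cvg_seq_eq_pos (fun=> 0)); last exact: cvg_cst.
  by move=> N _; rewrite !big_nil subrr mulr0.
move=> /andP[is_ us] hf hf'; have sub j : j \in s -> j \in i :: s.
  by rewrite inE orbC => ->.
have {}IH := IH us (fun j js => hf j (sub j js)) (fun j js => hf' j (sub j js)).
apply: (@cvg_seq_eq_pos (fun N => (N%:R * (f i N - l i)) * \prod_(j <- s) f j N
    + l i * (N%:R * (\prod_(j <- s) f j N - \prod_(j <- s) l j)))).
  by move=> N _; rewrite !big_cons; ring.
have -> : \sum_(j <- i :: s) l' j * \prod_(k <- i :: s | k != j) l k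
    = l' i * \prod_(j <- s) l j
      + l i * \sum_(j <- s) l' j * \prod_(k <- s | k != j) l k.
  rewrite big_cons big_cons eqxx /=; congr (_ * _ + _).
    rewrite big_seq_cond [RHS]big_seq; apply: eq_bigl => j.
    by case: (boolP (j \in s)) => //= js; apply: contraNneq is_ => <-.
  rewrite mulr_sumr; apply: eq_big_seq => j js; rewrite big_cons.
  by rewrite ifT 1?mulrCA//; apply: contraNneq is_ => ->.
apply: cvgD.
  apply: cvgM; first by apply: hf'; exact: mem_head.
  by apply: cvg_seq_prod => j js _; apply: hf; exact: sub.
by apply: cvgM; [exact: cvg_cst|exact: IH].
Qed.

Lemma sqrt_natV_double (N m : nat) :
  ((Num.sqrt N%:R : R)^-1 ^+ m.*2)%:C = (N%:R^-1) ^+ m.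
Proof.
rewrite -mul2n exprM exprVn sqr_sqrtr// rmorphXn /= -(rmorph_nat (real_complex R)).
by rewrite fmorphV.
Qed.

Lemma mxtrace_ntr N (M : 'M[R[i]]_N) : (0 < N)%N -> \tr M = N%:R * ntr M.
Proof. by move=> N0; rewrite /ntr mulrA divff ?mul1r// pnatr_eq0 -lt0n. Qed.

End ComplexSequences.

(** * Limit of the contribution of each pairing *)

Section Limits.
Variables (R : realType) (n : nat) (A : forall N : nat, 'I_n -> 'M[R[i]]_N).
Variables (B : algType R[i]) (phi phi' : {scalar B}) (a at_ : 'I_n -> B).
Hypothesis A_inf : joint_infinitesimal_limit_distribution A phi phi' a.
Hypothesis A_lim : joint_limit_distribution A phi a at_.

Lemma cvg_word (s : seq 'I_n) (e : 'I_n -> bool) : (0 < size s)%N ->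
  ((fun N => ntr (\prod_(i <- s) eps_mx (A N i) (e i))) : nat -> R[i]^o) @ \oo
  --> (phi (\prod_(i <- s) eps_var a at_ i (e i)) : R[i]^o).
Proof.
move=> s0; rewrite [X in phi X]big_tnth.
have h := @A_lim (size s) (tnth (in_tuple s)) (fun l => e (tnth (in_tuple s) l)) s0.
by apply: cvg_seq_eq_pos h => N _; rewrite [X in ntr X]big_tnth.
Qed.

Lemma cvg_word_inf (s : seq 'I_n) : (0 < size s)%N ->
  ((fun N => ntr (\prod_(i <- s) A N i)) : nat -> R[i]^o) @ \oo
    --> (phi (\prod_(i <- s) a i) : R[i]^o) /\
  ((fun N => N%:R * (ntr (\prod_(i <- s) A N i) - phi (\prod_(i <- s) a i)))
    : nat -> R[i]^o) @ \oo --> (phi' (\prod_(i <- s) a i) : R[i]^o).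
Proof.
move=> s0; have [h1 h2] := @A_inf (size s) (tnth (in_tuple s)) s0.
rewrite [X in phi X]big_tnth [X in phi' X]big_tnth; split.
  by apply: cvg_seq_eq_pos h1 => N _; rewrite [X in ntr X]big_tnth.
by apply: cvg_seq_eq_pos h2 => N _; rewrite [X in ntr X]big_tnth [X in phi X]big_tnth.
Qed.

Definition pairing_term (rho : {perm signed n}) (N : nat) : R[i] :=
  ((Num.sqrt N%:R)^-1 ^+ n)%:C *
  \sum_(J : {ffun signed n -> 'I_N} | [forall r, J (sdelta n (rho r)) == J r])
     \prod_k A N k (J (k, true)) (J (gamma n k, false)).

Lemma pairing_termE rho sg eta N : (0 < N)%N -> rho \in signed_pairing n ->
  cycle_signs rho sg eta ->
  pairing_term rho N = (N%:R^-1) ^+ n./2 * N%:R ^+ #|porbits sg| *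
    \prod_(c in porbits sg) ntr (\prod_(i <- cycle_seq sg c) eps_mx (A N i) (eta i)).
Proof.
move=> N0 rs sgP; rewrite /pairing_term (sum_signed_indices rs sgP (A N) N0).
have := odd_double_half n; rewrite (negbTE (signed_pairing_even rs)) add0n => n2.
have -> : ((Num.sqrt N%:R)^-1 ^+ n)%:C = (N%:R^-1) ^+ n./2 :> R[i].
  by rewrite -{1}n2 sqrt_natV_double.
rewrite -mulrA; congr (_ * _).
under eq_bigr do rewrite mxtrace_ntr//.
by rewrite big_split prodr_const.
Qed.

Lemma cycle_seq_size (sg : {perm 'I_n}) c : c \in porbits sg ->
  (0 < size (cycle_seq sg c))%N.
Proof.
case/cycle_seqP => x _ ->; rewrite size_traject lt0n; exact: card_porbit_neq0.
Qed.

(** With q = n/2 cycles the powers of N cancel; with fewer, a positive power of 1/N multiplies a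
    convergent product. *)
Lemma cvg_pairing_term rho sg eta : rho \in signed_pairing n ->
  cycle_signs rho sg eta -> (#|porbits sg| <= n./2)%N ->
  (pairing_term rho : nat -> R[i]^o) @ \oo -->
  ((if #|porbits sg| == n./2 then \prod_(c in porbits sg)
     phi (\prod_(i <- cycle_seq sg c) eps_var a at_ i (eta i)) else 0) : R[i]^o).
Proof.
move=> rs sgP small.
apply: (@cvg_seq_eq_pos _ (fun N => (N%:R^-1) ^+ (n./2 - #|porbits sg|) *
  \prod_(c in porbits sg) ntr (\prod_(i <- cycle_seq sg c) eps_mx (A N i) (eta i)))).
  move=> N N0; rewrite (pairing_termE N0 rs sgP); congr (_ * _).
  rewrite -{1}(subnK small) exprD -mulrA -exprMn mulVf ?expr1n ?mulr1//.
  by rewrite pnatr_eq0 -lt0n.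
have cw : ((fun N => \prod_(c in porbits sg)
      ntr (\prod_(i <- cycle_seq sg c) eps_mx (A N i) (eta i))) : nat -> R[i]^o) @ \oo
    --> (\prod_(c in porbits sg)
      phi (\prod_(i <- cycle_seq sg c) eps_var a at_ i (eta i)) : R[i]^o).
  by apply: cvg_seq_prod => c _ cs; apply: cvg_word; exact: cycle_seq_size.
case: ifP => [/eqP ->|ne].
  by rewrite subnn; under eq_fun do rewrite expr0 mul1r.
set L := \prod_(c in _) _ in cw; rewrite -(mul0r L); apply: cvgM cw.
have : (0 < n./2 - #|porbits sg|)%N by rewrite subn_gt0 ltn_neqAle ne.
case: (n./2 - _)%N => // q _; under eq_fun do rewrite exprS.
rewrite -(mul0r (0 ^+ q : R[i])); apply: cvgM; first exact: cvg_natC_inv.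
elim: q => [|q IH]; first by under eq_fun do rewrite expr0; exact: cvg_cst.
under eq_fun do rewrite exprS; rewrite exprS.
by apply: cvgM; [exact: cvg_natC_inv|exact: IH].
Qed.

(** Here q = n/2 + 1, so exactly one factor N survives, the one of the Leibniz rule; [nc_cycle_seq]
    matches the words of the traces with those of [block_word]. *)
Lemma cvg_nc_pairing_term p : (0 < n)%N -> is_pairing p -> nc_perm p ->
  ((fun N => pairing_term (double_perm p) N
     - N%:R * fun_part phi (porbits (gamma n * p)%g) a) : nat -> R[i]^o) @ \oo
  --> (dfun_part phi phi' (porbits (gamma n * p)%g) a : R[i]^o).
Proof.
move=> n0 pp pnc; set K := porbits _.
have K2 := nc_card_porbits pp pnc n0.
have Kn : #|K| = n./2.+1.
  by apply: double_inj; rewrite [LHS]K2 -[in LHS](odd_double_half n) doubleS;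
    have := pairing_even pp; rewrite card_ord => /negbTE ->.
have word c : c \in K -> (0 < size (enum c))%N.
  by move=> cK; rewrite -(nc_cycle_seq pp pnc cK); exact: cycle_seq_size.
rewrite /dfun_part -big_enum /=.
under [X in _ --> X]eq_bigr do rewrite -big_enum_cond.
apply: (@cvg_seq_eq_pos _ (fun N => N%:R *
  (\prod_(c <- enum K) ntr (\prod_(i <- enum c) A N i)
   - \prod_(c <- enum K) phi (block_word a c)))); last first.
  apply: cvg_seq_prodB; first exact: enum_uniq.
  - by move=> c; rewrite mem_enum => cK; exact: (cvg_word_inf (word c cK)).1.
  - by move=> c; rewrite mem_enum => cK; exact: (cvg_word_inf (word c cK)).2.
move=> N N0.
rewrite (pairing_termE N0 (double_perm_signed pp) (@double_perm_signs _ p)) -/K Kn.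
rewrite mulrBr /fun_part !big_enum /= exprS; congr (_ - _).
rewrite mulrCA -exprMn mulVf ?expr1n ?mulr1//; last by rewrite pnatr_eq0 -lt0n.
by congr (_ * _); apply: eq_bigr => c cK; rewrite (nc_cycle_seq pp pnc cK).
Qed.

End Limits.

Theorem theorem36 (R : realType)
  (d : nat -> measure_display)
  (Om : forall N : nat, measurableType (d N))
  (P : forall N : nat, probability (Om N) R)
  (g : forall N : nat, 'I_N * 'I_N -> {RV (P N) >-> R})
  (g_iid : forall N : nat, iid_std_normal (g N))
  (n : nat)
  (A : forall N : nat, 'I_n -> 'M[R[i]]_N)
  (B : algType R[i]) (phi phi' : {scalar B})
  (phi1 : phi 1 = 1) (phi'1 : phi' 1 = 0)
  (a at_ : 'I_n -> B)
  (A_inf : joint_infinitesimal_limit_distribution A phi phi' a)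
  (A_lim : joint_limit_distribution A phi a at_) :
  (fun N : nat =>
     N%:R * (cexpectation (P N)
               (fun w => ntr (\prod_(k < n) (goe (g N) w *m A N k)))
             - \sum_(pi in NC n)
                 cumulant_part (@semicircular _) pi *
                 fun_part phi (kreweras pi) a)
     : R[i]^o) @ \oo -->
  (\sum_(pi in NC n)
     cumulant_part (@semicircular _) pi * dfun_part phi phi' (kreweras pi) a
   + \sum_(rho in NC2delta n)
       cumulant_part (@semicircular _) (porbits rho) *
       fun_Kdelta phi rho a at_ : R[i]^o).
Proof.
set lhs := (X in X @ \oo --> _).
have sumNC (F : {set {set 'I_n}} -> R[i]) := sum_NC F.
rewrite (sumNC (fun K => dfun_part phi phi' K a)).
have [n0|n0] := posnP n.
  (* For n = 0 [gamma] has no cycle and the trace expansion does not apply. Both terms of the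
     difference equal 1 when N > 0, and both sums in the limit vanish. *)
  subst n; apply: (@cvg_seq_eq_pos _ (fun=> 0)).
    move=> N N0; rewrite /lhs (sumNC (fun K => fun_part phi K a)).
    rewrite [X in _ - X](_ : _ = 1); last first.
      rewrite (big_pred1 1%g) => [|p]; first by apply: big1 => c /imsetP[[]].
      have -> : p = 1%g by apply/permP => -[].
      rewrite /= eqxx; apply/andP; split; [by apply/forallP => -[]|].
      by apply/forallP => -[].
    rewrite (_ : cexpectation _ _ = 1) ?subrr ?mulr0//.
    have -> : (fun w => ntr (\prod_(k < 0) (goe (g N) w *m A N k))) = cst 1.
      apply/funext => w; rewrite big_ord0 /ntr [\tr _]mxtrace1.
      by rewrite mulVf// pnatr_eq0 -lt0n.
    by rewrite /cexpectation !expectation_cst.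
  rewrite (_ : _ + _ = 0); first exact: cvg_cst.
  rewrite big1 ?big1 ?addr0// => [rho|p _].
    by rewrite NC2deltaE => /and3P[_ /forallPn[[[]]]].
  by apply: big1 => c /imsetP[[]].
pose term := pairing_term A.
pose phi0 (p : {perm 'I_n}) := fun_part phi (porbits (gamma n * p)%g) a.
(* The subtracted sum is distributed over the non-crossing pairings, whose terms are the only ones
   to keep a factor N. *)
apply: (@cvg_seq_eq_pos _ (fun N =>
  \sum_(p | is_pairing p && nc_perm p) (term (double_perm p) N - N%:R * phi0 p)
  + \sum_(p | is_pairing p && ~~ nc_perm p) term (double_perm p) N
  + \sum_(rho | (rho \in signed_pairing n) && ~~ sign_preserving rho) term rho N)).
  move=> N N0; rewrite /lhs mulrBr (goe_trace_expectation _ (g_iid N) n0 N0).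
  rewrite (sumNC (fun K => fun_part phi K a)) mulr_sumr.
  transitivity (\sum_(rho in signed_pairing n) term rho N
    - N%:R * \sum_(p | is_pairing p && nc_perm p) phi0 p); first by [].
  rewrite (bigID (@sign_preserving n) (mem (signed_pairing n))) /= sum_sign_preserving.
  rewrite (bigID (@nc_perm n) (@is_pairing _)) /= sumrB mulr_sumr.
  by rewrite [LHS]addrAC; congr (_ + _); exact: addrAC.
have even (p : {perm 'I_n}) : is_pairing p -> ~~ odd n by move=> /pairing_even; rewrite card_ord.
have half2 : ~~ odd n -> n = n./2.*2.
  by move=> /negbTE ev; rewrite -{1}(odd_double_half n) ev.
(* The sum is extended by zeros to all [rho] with a pair of opposite signs, the range over which the
   limits are taken; membership in [NC2delta] amounts to having n/2 chosen cycles. *)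
have -> : \sum_(rho in NC2delta n) cumulant_part (@semicircular _) (porbits rho) *
      fun_Kdelta phi rho a at_
    = \sum_(rho | (rho \in signed_pairing n) && ~~ sign_preserving rho)
      (if #|porbits (Kdelta_sigma rho)| == n./2 then fun_Kdelta phi rho a at_ else 0).
  rewrite -big_mkcondr; apply: eq_big => [rho|rho]; rewrite NC2deltaE.
    case: (boolP (rho \in signed_pairing n)) => //= rs; congr (_ && _).
    rewrite (card_porbits_signs rs (Kdelta_cycle_signs rs)).
    by rewrite -[RHS](inj_eq double_inj) -half2 ?(signed_pairing_even rs).
  case/andP => rs _; rewrite cumulant_semicircular.
  rewrite (_ : [forall V in _, _] = true) ?mul1r//; apply/forall_inP => _ /imsetP[r _ ->].
  by rewrite card_pairing_porbit ?signed_pairing_pairing.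
(* The added 0 is the limit of the crossing terms. *)
rewrite -[X in X + _]addr0.
apply: cvgD; first apply: cvgD.
- by apply: cvg_seq_sum => p /andP[pp pnc]; exact: cvg_nc_pairing_term.
- have z0 : 0 = \sum_(p : {perm 'I_n} | is_pairing p && ~~ nc_perm p) 0 :> R[i].
    by rewrite big1_eq.
  rewrite [X in _ --> X]z0.
  apply: cvg_seq_sum => p /andP[pp pnc].
  have small : (#|porbits (gamma n * p)%g| < n./2)%N.
    rewrite -leq_double doubleS -half2 ?(even p pp)//.
    exact: crossing_card_porbits.
  have := cvg_pairing_term A_lim (double_perm_signed pp) (@double_perm_signs _ p) (ltnW small).
  by rewrite (ltn_eqF small).
- apply: cvg_seq_sum => rho /andP[rs opp].
  have sgP := Kdelta_cycle_signs rs.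
  apply: (cvg_pairing_term A_lim rs sgP).
  rewrite -leq_double -(card_porbits_signs rs sgP) -half2 ?(signed_pairing_even rs)//.
  exact: opposite_sign_card_porbits.
Qed.
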